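(* For $\beta>0$ small enough, for every $n\ge1$ and nonnegative integers $k_1,\dots,k_n$ there is a constant $L$ independent of $N$ such that $$\big|\nu_0(\varepsilon_1^{k_1}\cdots\varepsilon_n^{k_n})-\mathbb E\,\gamma_{k_1}\cdots\gamma_{k_n}\big|\le \frac LN.$$
   Context: Let $N\ge2$, $S_N=\{\vec\sigma\in\mathbb R^N:|\vec\sigma|=\sqrt N\}$, $\lambda_N$ its uniform probability measure. Let $\xi$ be three times continuously differentiable, $h\ne0$, $\beta>0$, and $q\in[0,1)$ the (assumed unique) solution of $h^2+\beta^2\xi'(q)=q/(1-q)^2$ (with $\xi'(q)\ge0$). Let $b=h^2(1-q)+\beta^2(1-q)\xi'(q)$, $z$ a standard Gaussian and $a=z\beta\sqrt{\xi'(q)}+h$. Define $\gamma_0=1$, $\gamma_1=a/(b+1)$ and for $k\ge2$, $\gamma_k=\frac{a}{b+1}\gamma_{k-1}+\frac{k-1}{b+1}\gamma_{k-2}$. For $\vec\sigma\in S_N$ write $\varepsilon=\sigma_N$ and $\hat\sigma_i=\sigma_i/\sqrt{(N-\varepsilon^2)/(N-1)}$, $i\le N-1$, so $\hat{\vec\sigma}\in S_{N-1}$. Let $H_{N-1}$ be a centered Gaussian process on $S_{N-1}$, independent of $z$, with $\frac1{N-1}\mathbb E H_{N-1}(\hat{\vec\sigma}^1)H_{N-1}(\hat{\vec\sigma}^2)=\xi((N-1)^{-1}\sum_{i\le N-1}\hat\sigma^1_i\hat\sigma^2_i)$. Define $H_0(\vec\sigma)=\beta H_{N-1}(\hat{\vec\sigma})+h\sum_{i\le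 N-1}\hat\sigma_i+\varepsilon a-\frac12\varepsilon^2 b$, the Gibbs average $\langle f\rangle_0=Z_0^{-n}\int_{S_N^n}f\exp\sum_{l\le n}H_0(\vec\sigma^l)d\lambda_N^n$ (with $Z_0=\int_{S_N}\exp H_0\,d\lambda_N$), and $\nu_0(f)=\mathbb E\langle f\rangle_0$. Here $\varepsilon_l=\sigma^l_N$ is the last coordinate of replica $l$. *)

(* Defs.v *)
From HB Require Import structures.
From mathcomp Require Import all_boot all_order all_algebra.
From mathcomp Require Import all_classical all_reals all_analysis.
Unset Implicit Arguments. Unset Strict Implicit. Unset Printing Implicit Defensive.
Import Order.TTheory GRing.Theory Num.Theory.
Import numFieldNormedType.Exports.
Local Open Scope classical_set_scope.
Local Open Scope ring_scope.

Section Defs.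
Context {R : realType}.

Definition C3 (f : R -> R) : Prop :=
  (forall x, derivable f x 1) /\ (forall x, derivable (derive1 f) x 1) /\
  (forall x, derivable (derive1n 2 f) x 1) /\ continuous (derive1n 3 f).

Definition sphere (n : nat) : set (n.-tuple R) :=
  [set s | \sum_(i < n) tnth s i ^+ 2 = n%:R].

Definition overlap {n : nat} (x y : n.-tuple R) : R :=
  n%:R^-1 * \sum_(i < n) tnth x i * tnth y i.

Definition mat_act {n : nat} (O : 'M[R]_n) (s : n.-tuple R) : n.-tuple R :=
  [tuple \sum_(j < n) O i j * tnth s j | i < n].

Definition uniform_on_sphere (n : nat) (lam : probability (n.-tuple R) R) :=
  lam (sphere n) = 1%E /\
  forall O : 'M[R]_n, O *m O^T = 1%:M ->
    forall A, measurable A -> lam ((mat_act O) @^-1` A) = lam A.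

Definition centered_gaussian {d} {T : measurableType d} (P : probability T R)
  (X : T -> R) (v : R) : Prop :=
  measurable_fun setT X /\
  ((v = 0 /\ P [set w | X w = 0] = 1%E) \/
   (0 < v /\ forall A : set R, measurable A ->
       P (X @^-1` A) = normal_prob 0 (Num.sqrt v) A)).

Definition std_gaussian {d} {T : measurableType d} (P : probability T R)
  (z : T -> R) : Prop := centered_gaussian P z 1.

(* H is a centered Gaussian process on S_m (jointly measurable in (omega, x)),
   with E H(x) H(y) = m * xi(R(x,y)) : every finite linear combination of
   values at points of S_m is centered Gaussian with the induced variance *)
Definition gaussian_process {d} {T : measurableType d} (P : probability T R)
  (m : nat) (xi : R -> R) (H : T -> m.-tuple R -> R) : Prop :=
  measurable_fun setT (fun p : T * m.-tuple R => H p.1 p.2) /\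
  forall (k : nat) (x : 'I_k -> m.-tuple R) (c : 'I_k -> R),
    (forall i, sphere m (x i)) ->
    centered_gaussian P (fun w => \sum_(i < k) c i * H w (x i))
      (\sum_(i < k) \sum_(j < k) c i * c j * (m%:R * xi (overlap (x i) (x j)))).

Definition indep_of_process {d} {T : measurableType d} (P : probability T R)
  (m : nat) (z : T -> R) (H : T -> m.-tuple R -> R) : Prop :=
  forall (k : nat) (x : 'I_k -> m.-tuple R) (A : 'I_k -> set R) (B : set R),
    (forall i, sphere m (x i)) -> (forall i, measurable (A i)) -> measurable B ->
    P (z @^-1` B `&` \bigcap_(i in [set i | True]) [set w | A i (H w (x i))])
    = (P (z @^-1` B) * P (\bigcap_(i in [set i | True]) [set w | A i (H w (x i))]))%E.

(* gamma_k via the recursion; gam_pair k = (gamma_k, gamma_{k+1}) *)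
Fixpoint gam_pair (a b : R) (k : nat) : R * R :=
  match k with
  | 0 => (1, a / (b + 1))
  | k'.+1 => let p := gam_pair a b k' in
             (p.2, a / (b + 1) * p.2 + k'.+1%:R / (b + 1) * p.1)
  end.
Definition gamma_seq (a b : R) (k : nat) : R := (gam_pair a b k).1.

(* For sigma in S_{M+1}: epsilon = last coordinate, hat sigma in S_M *)
Definition eps {M : nat} (s : M.+1.-tuple R) : R := tnth s ord_max.
Definition hat {M : nat} (s : M.+1.-tuple R) : M.-tuple R :=
  [tuple tnth s (widen_ord (leqnSn M) i) /
         Num.sqrt ((M.+1%:R - eps s ^+ 2) / M%:R) | i < M].

(* Iterated integral over n replicas: int dmu(x1) ... int dmu(xn) f [x1;...;xn]
   (the integral over the product measure mu^n). *)
Fixpoint iter_int {d} {T : measurableType d} (mu : {measure set T -> \bar R})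
  (n : nat) (f : seq T -> R) : R :=
  match n with
  | 0 => f [::]
  | n'.+1 => Rintegral mu setT (fun x => iter_int mu n' (fun s => f (x :: s)))
  end.

Definition gibbs_avg {d} {T : measurableType d} (mu : {measure set T -> \bar R})
  (H0 : T -> R) (n : nat) (f : seq T -> R) : R :=
  iter_int mu n (fun s => f s * expR (\sum_(l < n) H0 (nth point s l)))
  / (Rintegral mu setT (fun x => expR (H0 x))) ^+ n.

End Defs.

(* Main.v *)
(* The last coordinate [eps] and the normalized remaining coordinates [hat] of a
   uniform point of the sphere are independent, so [exp H0] is a product of a
   function of [hat] and of [exp (a eps - b eps^2 / 2)], and the first factor
   cancels in the Gibbs average, which becomes a product of one-dimensional
   moments.  Independence is the uniqueness of the rotation invariant probability
   measure, for which invariance under reflections is enough.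

   Integration by parts on the sphere, obtained by differentiating along a
   one-parameter family of reflections, reads
     M E[eps g(eps)] = E[(M + 1 - eps^2) g'(eps)].
   Applied to [g(x) = x^k exp (a x - b x^2 / 2)] it shows that the moments satisfy
   the recursion defining [gamma_k] up to an error [O((1 + a^2)^s / M)], and it
   bounds the even moments by powers of [1 + a^2].  As [a] is Gaussian, all
   powers of [1 + a^2] have a finite mean, independent of [N]. *)
Require Import Defs.
From HB Require Import structures.
From mathcomp Require Import all_boot all_order all_algebra.
From mathcomp Require Import all_classical all_reals all_analysis.
From mathcomp Require Import measurable_realfun ring lra.
Import Order.TTheory GRing.Theory Num.Theory.
Import numFieldNormedType.Exports.
Local Open Scope classical_set_scope.
Local Open Scope ring_scope.

(** * Reflections *)

(** Integration by parts does not close the moments: the relation for the moment of order [k + 2]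
    also involves those of order [k + 3] and [k + 4], with coefficients of order 1 against a leading
    factor [M]. So every moment has to be bounded before the relation can be compared with the
    recursion of [gamma_seq]. The bound is uniform in [M] because the only dangerous term, the one
    in [b], has a sign: [b >= 0], and [M + 1 - eps^2 >= 0] on the sphere. Conditioning on a value of
    [eps] is avoided. For an event [E] about [eps], the law of [hat] restricted to [E] is a finite
    measure that is invariant under reflections, and it is compared with [P E] times the law of
    [hat]. The estimates are made for a fixed disorder, which survives only through [a]. For
    exceptional disorder the partition function may be infinite and the factor in [hat] cannot be
    cancelled; a first moment bound shows that this has probability 0. *)

Section reflections.
Context {R : realType} {n : nat}.
Implicit Types (x y v : n.-tuple R) (c : R).

Definition dot x y : R := \sum_(i < n) tnth x i * tnth y i.

(* For [v = 0] this is the identity, because [/ 0 = 0]. *)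
Definition refl v x : n.-tuple R :=
  [tuple tnth x i - 2 * dot v x / dot v v * tnth v i | i < n].

Lemma dotC x y : dot x y = dot y x.
Proof. by apply: eq_bigr => i _; rewrite mulrC. Qed.

Lemma dotxx_eq0 x : dot x x = 0 -> forall i, tnth x i = 0.
Proof.
move=> /eqP; rewrite psumr_eq0; last by move=> i _; rewrite -expr2 sqr_ge0.
by move=> /allP x0 i; have := x0 i (mem_index_enum i); rewrite mulf_eq0 orbb => /eqP.
Qed.

Lemma sphereE x : sphere n x <-> dot x x = n%:R.
Proof. by rewrite /sphere /dot /=; under eq_bigr do rewrite expr2. Qed.

Lemma dot_reflr x v y : dot x (refl v y) = dot x y - 2 * dot v y / dot v v * dot x v.
Proof.
rewrite /refl; set c := _ / _; rewrite /dot mulr_sumr -sumrB.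
by apply: eq_bigr => i _; rewrite tnth_mktuple; ring.
Qed.

Lemma dot_refl x v y : dot x (refl v y) = dot (refl v x) y.
Proof.
by rewrite dot_reflr [RHS]dotC dot_reflr (dotC y v) (dotC y x) (dotC v x); ring.
Qed.

Definition sub_tuple x y : n.-tuple R := [tuple tnth x i - tnth y i | i < n].

Lemma dot_sub_tuple x y z : dot (sub_tuple x y) z = dot x z - dot y z.
Proof.
by rewrite /dot -sumrB; apply: eq_bigr => i _; rewrite tnth_mktuple mulrBl.
Qed.

Lemma dist_tupleE x y :
  dot (sub_tuple x y) (sub_tuple x y) = dot x x + dot y y - 2 * dot x y.
Proof.
by rewrite dot_sub_tuple !(dotC _ (sub_tuple _ _)) !dot_sub_tuple (dotC y x); ring.
Qed.

Lemma tnth_refl v x i :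
  tnth (refl v x) i = tnth x i - 2 * dot v x / dot v v * tnth v i.
Proof. exact: tnth_mktuple. Qed.

Lemma reflK v : involutive (refl v).
Proof.
move=> x; apply: eq_from_tnth => i; rewrite !tnth_refl dot_reflr.
have [->|v0] := eqVneq (dot v v) 0; first by rewrite invr0 !(mulr0, mul0r) !subr0.
by field.
Qed.

(** The mirror is the perpendicular bisector of [x] and [y]. For [x = y] its normal vanishes and
    [refl] is the identity, so this case is covered too. Reflections are therefore transitive on the
    sphere. *)
Lemma refl_swap x y : dot x x = dot y y -> refl (sub_tuple x y) x = y.
Proof.
move=> xy; apply: eq_from_tnth => i; rewrite !tnth_mktuple.
have vx : 2 * dot (sub_tuple x y) x = dot (sub_tuple x y) (sub_tuple x y).
  by rewrite dist_tupleE dot_sub_tuple (dotC y x) -xy; ring.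
rewrite vx; have [v0|v0] := eqVneq (dot (sub_tuple x y) (sub_tuple x y)) 0.
  by have := dotxx_eq0 _ v0 i; rewrite tnth_mktuple v0 mul0r mul0r; lra.
by rewrite divff// mul1r subKr.
Qed.

(** The Householder matrix, since [uniform_on_sphere] expresses invariance through orthogonal
    matrices. *)
Definition refl_mx v : 'M[R]_n :=
  \matrix_(i, j) ((i == j)%:R - 2 / dot v v * tnth v i * tnth v j).

Lemma refl_mxE v x : mat_act (refl_mx v) x = refl v x.
Proof.
apply: eq_from_tnth => i; rewrite !tnth_mktuple.
under eq_bigr do rewrite mxE mulrBl.
rewrite sumrB (bigD1 i)//= eqxx mul1r big1 ?addr0; last first.
  by move=> j ji; rewrite eq_sym (negbTE ji) mul0r.
congr (_ - _); transitivity (2 / dot v v * tnth v i * dot v x); last by ring.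
by rewrite [in RHS]mulr_sumr; apply: eq_bigr => j _; ring.
Qed.

Lemma refl_mx_orthogonal v : refl_mx v *m (refl_mx v)^T = 1%:M.
Proof.
apply/matrixP => i k; rewrite !mxE.
pose c := 2 / dot v v.
(* Expansion of [(1 - c v v^T)^2]. The terms cancel because [c^2 |v|^2 = 2 c], also for [v = 0],
   where [c = 0] by the convention on inverses. *)
transitivity ((i == k)%:R - c * tnth v i * tnth v k - c * tnth v i * tnth v k
   + c ^+ 2 * dot v v * tnth v i * tnth v k).
  under eq_bigr do rewrite !mxE.
  transitivity (\sum_(j < n) ((i == j)%:R * (k == j)%:R
     - (k == j)%:R * (c * tnth v i * tnth v j)
     - (i == j)%:R * (c * tnth v k * tnth v j)
     + c ^+ 2 * (tnth v j * tnth v j) * tnth v i * tnth v k)).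
    by apply: eq_bigr => j _; rewrite -/c; ring.
  have delta (l : 'I_n) (F : 'I_n -> R) : \sum_(j < n) (l == j)%:R * F j = F l.
    rewrite (bigD1 l)//= eqxx mul1r big1 ?addr0// => j jl.
    by rewrite eq_sym (negbTE jl) mul0r.
  rewrite big_split/= !sumrB !delta (eq_sym k i) -!mulr_suml -mulr_sumr -/(dot v v).
  by ring.
have [v0|v0] := eqVneq (dot v v) 0.
  by rewrite /c v0 invr0; ring.
by rewrite /c; field.
Qed.

Lemma uniform_on_sphere_refl (lam : probability (n.-tuple R) R) v A :
  uniform_on_sphere n lam -> measurable A -> lam (refl v @^-1` A) = lam A.
Proof.
move=> [_ inv] mA; rewrite -[RHS](inv _ (refl_mx_orthogonal v) _ mA).
by congr (lam _); apply/seteqP; split => x /=; rewrite refl_mxE.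
Qed.

Lemma measurable_dot d (T : measurableType d) (f g : T -> n.-tuple R) :
  measurable_fun setT f -> measurable_fun setT g ->
  measurable_fun setT (fun t => dot (f t) (g t)).
Proof.
move=> mf mg; apply: measurable_sum => i; apply: measurable_funM.
- exact: (measurableT_comp (measurable_tnth i) mf).
- exact: (measurableT_comp (measurable_tnth i) mg).
Qed.

Lemma measurable_refl v : measurable_fun setT (refl v).
Proof.
apply/measurable_fun_tnthP => i.
rewrite (_ : _ \o _ = fun x => tnth x i - 2 * dot v x / dot v v * tnth v i); last first.
  by apply/funext => x; rewrite /= tnth_mktuple.
apply: measurable_funB; first exact: measurable_tnth.
apply: measurable_funM => //; apply: measurable_funM => //; apply: measurable_funM => //.
by apply: measurable_dot.
Qed.

Lemma measurable_sphere : measurable (sphere n : set (n.-tuple R)).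
Proof.
rewrite (_ : sphere n = (fun x => dot x x) @^-1` [set n%:R]); last first.
  by apply/seteqP; split => x /=; rewrite sphereE.
by rewrite -[X in measurable X]setTI; apply: measurable_dot.
Qed.

End reflections.

(** * Uniqueness of the rotation invariant measure *)

Section equidistribution.
Context {R : realType} {d} {T : measurableType d} (P : probability T R) {m : nat}
  (X : T -> m.-tuple R).
Hypothesis mX : measurable_fun setT X.
Hypothesis XS : P (X @^-1` sphere m) = 1%E.

Let S := X @^-1` sphere m.

(** Invariance of the law of [X] restricted to [E]. The case [E = setT] is invariance of the law
    itself. *)
Definition refl_invariant (E : set T) := forall v A, measurable A ->
  P (X @^-1` (refl v @^-1` A) `&` E) = P (X @^-1` A `&` E).

(** Between points of the sphere, [dist_tupleE] turns this into the open ball of squared radius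
    [2 (m - r)], so caps shrink as [r] increases to [m]. *)
Definition cap (x : m.-tuple R) (r : R) : set T := [set t | r < dot x (X t)].

Lemma measurable_preimage_X A : measurable A -> measurable (X @^-1` A).
Proof. by move=> mA; rewrite -[X in measurable X]setTI; exact: mX. Qed.

Let mS : measurable S.
Proof. by apply: measurable_preimage_X; exact: measurable_sphere. Qed.

Let PIS A : measurable A -> P (A `&` S) = P A.
Proof.
move=> mA; apply/eqP; rewrite eq_le le_measure ?inE//=; last exact: measurableI.
have PC : P (~` S) = 0%E by rewrite probability_setC// XS subee.
rewrite -[leRHS]adde0 -[X in (_ <= _ + X)%E]PC.
apply: (@le_trans _ _ (P ((A `&` S) `|` ~` S))).
  apply: le_measure; rewrite ?inE//.
    by apply: measurableU; [exact: measurableI|exact: measurableC].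
  by move=> t At; have [St|St] := pselect (S t); [left|right].
by apply: measureU2; [exact: measurableI|exact: measurableC].
Qed.

Lemma measurable_cap x r : measurable (cap x r).
Proof.
rewrite (_ : cap x r = (fun t => dot x (X t)) @^-1` `]r, +oo[); last first.
  by apply/seteqP; split => t /=; rewrite in_itv/= andbT.
by rewrite -[X in measurable X]setTI; apply: measurable_dot.
Qed.

(** The reflection that swaps the two centres maps one cap onto the other. *)
Lemma cap_const E x y r : refl_invariant E -> sphere m x -> sphere m y ->
  P (cap x r `&` E) = P (cap y r `&` E).
Proof.
move=> invE /sphereE xm /sphereE ym.
pose A := [set z : m.-tuple R | r < dot x z].
have mA : measurable A.
  rewrite (_ : A = (fun z => dot x z) @^-1` `]r, +oo[); last first.
    by apply/seteqP; split => t /=; rewrite in_itv/= andbT.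
  by rewrite -[X in measurable X]setTI; apply: measurable_dot.
rewrite -[LHS]/(P (X @^-1` A `&` E)) -(invE (sub_tuple x y))//.
congr (P (_ `&` _)); apply/seteqP.
by split=> t; rewrite /cap /A/= dot_refl refl_swap// xm ym.
Qed.

(** Tonelli for the pairs [(s, t)] in [A * B] with [r < dot (X s) (X t)], a symmetric relation. *)
Lemma double_count A B r : measurable A -> measurable B ->
  (\int[P]_(s in A) P (B `&` cap (X s) r) =
   \int[P]_(t in B) P (A `&` cap (X t) r))%E.
Proof.
move=> mA mB.
pose C := (A `*` B) `&` [set st | r < dot (X st.1) (X st.2)].
have mC : measurable C.
  apply: measurableI; first exact: measurableX.
  rewrite (_ : [set _ | _] = (fun st : T * T => dot (X st.1) (X st.2)) @^-1` `]r, +oo[); last first.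
    by apply/seteqP; split => t /=; rewrite in_itv/= andbT.
  rewrite -[X in measurable X]setTI; apply: measurable_dot => //.
  - exact: measurableT_comp.
  - exact: measurableT_comp.
have := @indic_fubini_tonelli _ _ _ _ R P P C mC.
rewrite indic_fubini_tonelli_FE// indic_fubini_tonelli_GE// => FG.
rewrite [LHS]integral_mkcond [RHS]integral_mkcond.
transitivity (\int[P]_x (P \o xsection C) x)%E;
  last transitivity (\int[P]_x (P \o ysection C) x)%E => //.
- apply: eq_integral => s _; rewrite patchE /=; case: ifPn => sA.
    congr (P _); apply/seteqP; split => t /=; rewrite /xsection/= inE/=.
      by move=> [? ?]; split => //; split => //; exact: set_mem.
    by move=> [[_ ?] ?].
  rewrite -[LHS](measure0 P); congr (P _); apply/seteqP; split => t //=.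
  rewrite /xsection/= inE/= => -[[? _] _].
  by move/negP : sA => /(_ (mem_set _)); exact.
- apply: eq_integral => s _; rewrite patchE /=; case: ifPn => sA.
    congr (P _); apply/seteqP; split => t /=; rewrite /ysection/= inE/=.
      by move=> [[? ?] ?]; split => //; rewrite /cap/= dotC.
    by move=> [? ?]; split; [split => //; exact: set_mem|rewrite /= dotC].
  rewrite -[RHS](measure0 P); congr (P _); apply/seteqP; split => t //=.
  rewrite /ysection/= inE/= => -[[_ ?] _].
  by move/negP : sA => /(_ (mem_set _)); exact.
Qed.

Lemma measurable_cap_prob B r : measurable B ->
  measurable_fun setT (fun s => P (B `&` cap (X s) r)).
Proof.
move=> mB.
pose C := (setT `*` B) `&` [set st | r < dot (X st.1) (X st.2)].
have mC : measurable C.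
  apply: measurableI; first exact: measurableX.
  rewrite (_ : [set _ | _] = (fun st : T * T => dot (X st.1) (X st.2)) @^-1` `]r, +oo[); last first.
    by apply/seteqP; split => t /=; rewrite in_itv/= andbT.
  rewrite -[X in measurable X]setTI; apply: measurable_dot => //.
  - exact: measurableT_comp.
  - exact: measurableT_comp.
have := @measurable_fun_xsection _ _ _ _ R P C mC.
apply: eq_measurable_fun => s _ /=; congr (P _).
apply/seteqP; split => t; rewrite /xsection/= inE/=; first by move=> [[_ ?] ?].
by move=> [? ?].
Qed.

(* A null cap would make the whole sphere null, by covering it with countably
   many cubes of small side. *)
Lemma cap_gt0 x r : refl_invariant setT -> sphere m x -> r < m%:R ->
  (0 < P (cap x r))%E.
Proof.
move=> inv Sx rm; rewrite lt_neqAle measure_ge0 andbT; apply/eqP => P0.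
have cap0 y : sphere m y -> P (cap y r) = 0%E.
  by move=> Sy; have := cap_const _ _ _ r inv Sy Sx; rewrite !setIT => ->.
(* Two points of the sphere in one cell have squared distance at most [m e^2 <= m - r], so twice
   their dot product is at least [m + r], which exceeds [2 r]. The denominator [m + 1] also covers
   [m = 0]. *)
pose e := Num.sqrt ((m%:R - r) / m.+1%:R).
have e0 : 0 < e by rewrite sqrtr_gt0 divr_gt0// subr_gt0.
have e2 : e ^+ 2 = (m%:R - r) / m.+1%:R.
  by rewrite sqr_sqrtr// ltW// divr_gt0// subr_gt0.
pose cell (p : {ffun 'I_m -> int}) : set T :=
  [set t | forall i, Num.floor (tnth (X t) i / e) = p i] `&` S.
pose F k := if unpickle k is Some p then cell p else set0.
have cell0 p : P.-negligible (cell p).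
  have [->|/set0P[t0 [pt0 St0]]] := eqVneq (cell p) set0.
    exact: negligible_set0.
  exists (cap (X t0) r); split; [exact: measurable_cap|exact: cap0|].
  move=> t [pt St]; rewrite /cap/=.
  have : dot (sub_tuple (X t0) (X t)) (sub_tuple (X t0) (X t)) <= m%:R * e ^+ 2.
    rewrite /dot mulr_natl -[X in _ *+ X]card_ord -sumr_const; apply: ler_sum => i _.
    rewrite tnth_mktuple -expr2 -ler_sqrt ?sqr_ge0// !sqrtr_sqr (ger0_norm (ltW e0)).
    have fl (u : R) : e * (Num.floor (u / e))%:~R <= u < e * (Num.floor (u / e))%:~R + e.
      rewrite mulrC -ler_pdivlMr// ge_floor/= -[X in _ < _ + X]mulr1.
      by rewrite mulrC -mulrDr mulrC -ltr_pdivrMr// -intrD1 floorD1_gt.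
    have := fl (tnth (X t0) i); have := fl (tnth (X t) i).
    rewrite pt pt0; set w := e * _ => /andP[? ?] /andP[? ?].
    by rewrite ler_norml; apply/andP; split; lra.
  rewrite dist_tupleE; move/sphereE : St0 => ->; move/sphereE : St => ->.
  rewrite e2.
  have : m%:R * ((m%:R - r) / m.+1%:R) <= m%:R - r.
    by rewrite mulrCA ger_pMr ?subr_gt0// ler_pdivrMr// mul1r ler_nat.
  move: (_ * (_ / _)) => w; lra.
have : P.-negligible S.
  apply: (@negligibleS _ _ _ _ (\bigcup_k F k)); last first.
    apply: negligible_bigcup => k; rewrite /F; case: unpickle => [p|].
      exact: cell0.
    exact: negligible_set0.
  move=> t St; exists (pickle [ffun i => Num.floor (tnth (X t) i / e)]) => //.
  by rewrite /F pickleK; split => // i; rewrite ffunE.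
by move/(measure_negligible mS) => /eqP; rewrite /= XS onee_eq0.
Qed.

(** [double_count] between [E] and the whole sphere: by [cap_const] both integrands are constant. *)
Lemma cap_count E x r : measurable E -> refl_invariant E ->
  refl_invariant setT -> sphere m x ->
  P (E `&` cap x r) = (P E * P (cap x r))%E.
Proof.
move=> mE invE invT Sx.
have mC y : measurable (cap y r) by exact: measurable_cap.
have := double_count (E `&` S) S r (measurableI _ _ mE mS) mS.
rewrite (eq_integral (cst (P (cap x r)))); last first.
  move=> s /set_mem[Es Ss] /=; rewrite setIC PIS//.
  by have := cap_const _ _ _ r invT Ss Sx; rewrite !setIT.
rewrite integral_cst; last exact: measurableI.
rewrite (eq_integral (cst (P (E `&` cap x r)))); last first.
  move=> s /set_mem Ss /=; rewrite setIAC PIS; last exact: measurableI.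
  by rewrite !(setIC E); exact: cap_const.
by rewrite integral_cst//= -/S PIS// XS mule1 muleC => ->.
Qed.

(* Christensen's argument: on an open set, 1 is the limit of the fraction of a
   cap filled by the set, and Fatou plus [double_count] transfers this from one
   measure to the other. *)
Lemma open_prob_le E U : measurable E -> refl_invariant E ->
  refl_invariant setT -> measurable U ->
  (forall x, sphere m x -> U x -> exists2 r, r < m%:R &
     forall y, sphere m y -> r < dot x y -> U y) ->
  (P (X @^-1` U `&` E) <= P E * P (X @^-1` U))%E.
Proof.
move=> mE invE invT mU openU.
have mXU : measurable (X @^-1` U) by exact: measurable_preimage_X.
have [t0 St0] : exists t, S t.
  apply/set0P/eqP => S0; have := XS; rewrite -/S S0 measure0 => /esym/eqP.
  by rewrite onee_eq0.
pose r n : R := m%:R - n.+1%:R^-1.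
have rm n : r n < m%:R by rewrite /r ltrBlDr ltrDl invr_gt0.
pose g n := fine (P (cap (X t0) (r n))).
have gE n : P (cap (X t0) (r n)) = (g n)%:E.
  by rewrite fineK// fin_num_measure//; exact: measurable_cap.
have g0 n : 0 < g n by rewrite -lte_fin -gE; exact: cap_gt0.
pose V := X @^-1` U `&` S; pose D := X @^-1` U `&` E `&` S.
have mV : measurable V by exact: measurableI.
have mXUE : measurable (X @^-1` U `&` E) by exact: measurableI.
have mD : measurable D by exact: measurableI.
pose f n s := ((g n)^-1%:E * P (V `&` cap (X s) (r n)))%E.
have f0 n s : (0 <= f n s)%E.
  by rewrite mule_ge0// lee_fin invr_ge0 ltW.
have mf n : measurable_fun D (f n).
  apply: measurable_funTS; apply: emeasurable_funM => //.
  exact: measurable_cap_prob.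
(* After [double_count] the integrand is the mass of [D] in a cap, at most that of [E] in it, which
   [cap_count] evaluates; the cap mass [g n] then cancels. *)
have intf n : (\int[P]_(s in D) f n s <= P E * P (X @^-1` U))%E.
  rewrite ge0_integralZl//; last 2 first.
  - by apply: measurable_funTS; exact: measurable_cap_prob.
  - by rewrite lee_fin invr_ge0 ltW.
  rewrite double_count// muleC lee_pdivrMr//.
  rewrite (@le_trans _ _ (\int[P]_(t in V) cst (P E * (g n)%:E) t))%E//.
    apply: ge0_le_integral => //.
    - by apply: measurable_funTS; exact: measurable_cap_prob.
    - move=> t [Ut St]; rewrite /= -gE.
      have <- : P (cap (X t) (r n)) = P (cap (X t0) (r n)).
        by have := cap_const _ _ _ (r n) invT St St0; rewrite !setIT.
      rewrite -cap_count//; apply: le_measure; rewrite ?inE.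
      + by apply: measurableI => //; exact: measurable_cap.
      + by apply: measurableI => //; exact: measurable_cap.
      + by move=> s [[[]]].
  by rewrite integral_cst//= /V PIS// muleAC.
rewrite -(PIS (X @^-1` U `&` E))// -/D.
have -> : P D = (\int[P]_(s in D) limn_einf (f ^~ s))%E.
  rewrite (eq_integral (cst 1%E)); first by rewrite integral_cst// mul1e.
  move=> s /set_mem[[Us Es] Ss]; have [r0 r0m Ur0] := openU _ Ss Us.
  have e0 : 0 < m%:R - r0 by rewrite subr_gt0.
  suff : f ^~ s @ \oo --> 1%E by move=> /cvg_limn_einf_sup[->].
  apply: cvg_near_cst; near=> n; rewrite /f.
  have -> : P (V `&` cap (X s) (r n)) = (g n)%:E.
    have mC : measurable (cap (X s) (r n)) by exact: measurable_cap.
    have := cap_const _ _ _ (r n) invT Ss St0; rewrite !setIT gE => <-.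
    rewrite -[RHS]PIS//; congr (P _); apply/seteqP; split => t.
      by move=> [[]].
    move=> [ct St]; split => //; split => //; apply: Ur0 => //.
    apply: lt_trans ct; rewrite /r ltrBrDr -ltrBrDl.
    by near: n; exact: (near_infty_natSinv_lt (PosNum e0)).
  by rewrite -EFinM mulVf// gt_eqF.
apply: le_trans (fatou _ mD mf (fun n s _ => f0 n s)) _.
rewrite limn_einf_lim; apply: lime_le; first exact: is_cvg_einfs.
apply: nearW => n; apply: le_trans (intf n).
by apply: ereal_inf_lbound; exists n => /=.
Unshelve. all: by end_near. Qed.

End equidistribution.

(** * Open boxes: a generating pi-system of relatively open sets *)

Section boxes.
Context {R : realType} {m : nat}.

Definition open_box (U : set (m.-tuple R)) := exists A : 'I_m -> set R,
  (forall i, open (A i)) /\ U = [set x | forall i, A i (tnth x i)].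

Lemma open_boxI : setI_closed open_box.
Proof.
move=> _ _ [A [oA ->]] [B [oB ->]]; exists (fun i => A i `&` B i).
split=> [i|]; first exact: openI.
apply/seteqP; split => x /=; first by move=> [Ax Bx] i.
by move=> AB; split => i; case: (AB i).
Qed.

Lemma open_boxT : open_box setT.
Proof.
by exists (fun=> setT); split => [i|]; [exact: openT|apply/seteqP; split].
Qed.

Lemma measurable_tupleE : @measurable _ (m.-tuple R) = <<s open_box >>.
Proof.
apply/seteqP; split; last first.
  apply: smallest_sub; first exact: sigma_algebra_measurable.
  move=> _ [A [oA ->]].
  rewrite (_ : [set _ | _] = \bigcap_(i : 'I_m)
      ((fun x : m.-tuple R => tnth x i) @^-1` A i)); last first.
    by apply/seteqP; split => x /=; [move=> Ax i _; exact: Ax|move=> Ax i; exact: (Ax i)].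
  apply: fin_bigcap_measurable => // i _.
  by rewrite -[X in measurable X]setTI; apply: measurable_tnth => //; exact: open_measurable.
apply: smallest_sub; first exact: smallest_sigma_algebra.
rewrite -bigcup_seq; apply: bigcup_sub => i _ _ [B mB <-].
(* The sets whose preimage under the [i]-th coordinate is generated by boxes form a sigma-algebra,
   so open intervals suffice. *)
pose F : set (set R) := image_set_system setT (fun x : m.-tuple R => tnth x i) <<s open_box >>.
suff : F B by [].
have sF : sigma_algebra setT F by apply: sigma_algebra_image; exact: smallest_sigma_algebra.
move: B mB; change ((ocitv (R:=R)).-sigma.-measurable `<=` F).
rewrite RGenOpens.measurableE; apply: smallest_sub => // _ [x [y ->]].
apply: sub_sigma_algebra; exists (fun j => if j == i then `]x, y[%classic else setT).
split => [j|].
  by case: ifP => _; [exact: interval_open|exact: openT].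
apply/seteqP; split => z /=; rewrite ?setTI.
  by move=> [_ zi] j; case: ifPn => // /eqP->.
by move=> /(_ i); rewrite eqxx.
Qed.

Lemma open_box_cap (U : set (m.-tuple R)) x : open_box U -> sphere m x -> U x ->
  exists2 r, r < m%:R & forall y, sphere m y -> r < dot x y -> U y.
Proof.
move=> [A [oA ->]] Sx Ax.
have [e [e0 eA]] : exists e : R, 0 < e /\ forall i, ball (tnth x i) e `<=` A i.
  have : \forall e \near (0:R)^'+, forall i, ball (tnth x i) e `<=` A i.
    apply: filter_forall => i; have := open_nbhs_nbhs (conj (oA i) (Ax i)).
    rewrite -nbhs_ballE => -[e /= e0 eAi]; near=> t; apply: subset_trans eAi.
    by apply: le_ball; near: t; exact: nbhs_right_le.
  move=> [e /= e0 H]; exists (e / 2); split; first exact: divr_gt0.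
  apply: H => /=; rewrite ?divr_gt0// sub0r normrN gtr0_norm ?divr_gt0//.
  by rewrite ltr_pdivrMr// ltr_pMr// ltr1n.
(* On the sphere [dot x y > m - e^2 / 2] means that the squared distance is below [e^2], which
   bounds every coordinate difference by [e]. *)
exists (m%:R - e ^+ 2 / 2); first by rewrite ltrBlDr ltrDl divr_gt0// exprn_gt0.
move=> y Sy xy i; apply: eA; rewrite /ball/=.
have : dot (sub_tuple x y) (sub_tuple x y) < e ^+ 2.
  by rewrite dist_tupleE; move/sphereE : Sx => ->; move/sphereE : Sy => ->; lra.
rewrite /dot (bigD1 i)//= tnth_mktuple -expr2 => xye.
have : (tnth x i - tnth y i) ^+ 2 < e ^+ 2.
  apply: le_lt_trans xye; rewrite lerDl sumr_ge0// => j _.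
  by rewrite -expr2 sqr_ge0.
by rewrite -[X in X < _]real_normK ?num_real// ltr_pXn2r// nnegrE ltW.
Unshelve. all: by end_near. Qed.

End boxes.

Section independence.
Context {R : realType} {d} {T : measurableType d} (P : probability T R) {m : nat}
  (X : T -> m.-tuple R).
Hypothesis mX : measurable_fun setT X.
Hypothesis XS : P (X @^-1` sphere m) = 1%E.

(** The inequalities of [open_prob_le] for [E] and for its complement add up to an equality, hence
    both are equalities on open boxes. Two finite measures that agree on a generating pi-system
    coincide. *)
Lemma refl_invariant_indep E A : measurable E -> measurable A ->
  refl_invariant P X E -> refl_invariant P X setT ->
  P (X @^-1` A `&` E) = (P E * P (X @^-1` A))%E.
Proof.
move=> mE mA invE invT.
have mXA B : measurable B -> measurable (X @^-1` B) by exact: measurable_preimage_X.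
have splitE B : measurable B ->
    P (X @^-1` B) = (P (X @^-1` B `&` E) + P (X @^-1` B `&` ~` E))%E.
  by move=> mB; rewrite (measureDI P (mXA _ mB) mE) addeC setDE.
have invC : refl_invariant P X (~` E).
  move=> v B mB; have mrB : measurable (refl v @^-1` B).
    by rewrite -[X in measurable X]setTI; exact: measurable_refl.
  have := invT v B mB; rewrite !setIT (splitE _ mrB) (splitE _ mB) invE//.
  have fB : P (X @^-1` B `&` E) \is a fin_num.
    by rewrite fin_num_measure//; apply: measurableI => //; exact: mXA.
  move: fB; case: (P (X @^-1` B `&` E)) => [u| |]// _.
  by rewrite !(addeC u%:E) => /(congr1 (fun z => z - u%:E)%E); rewrite !addeK.
have boxE U : open_box U -> P (X @^-1` U `&` E) = (P E * P (X @^-1` U))%E.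
  move=> oU; have mU : measurable U by rewrite measurable_tupleE; exact: sub_sigma_algebra.
  have mXU := mXA _ mU.
  have le F : measurable F -> refl_invariant P X F ->
      (P (X @^-1` U `&` F) <= P F * P (X @^-1` U))%E.
    by move=> mF invF; apply: open_prob_le => // x Sx Ux; exact: open_box_cap.
  have leE := le _ mE invE; have leC := le _ (measurableC mE) invC.
  have fU : P (X @^-1` U) \is a fin_num by rewrite fin_num_measure.
  have fE : P E \is a fin_num by rewrite fin_num_measure.
  have f1 : P (X @^-1` U `&` E) \is a fin_num by rewrite fin_num_measure//; exact: measurableI.
  have f2 : P (X @^-1` U `&` ~` E) \is a fin_num.
    by rewrite fin_num_measure//; apply: measurableI => //; exact: measurableC.
  move: leE leC (splitE _ mU); rewrite probability_setC//.
  move: fU fE f1 f2.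
  case: (P (X @^-1` U)) => [u| |]//; case: (P E) => [e| |]//.
  case: (P (X @^-1` U `&` E)) => [a| |]//.
  case: (P (X @^-1` U `&` ~` E)) => [c| |]// _ _ _ _.
  rewrite -!EFinB -!EFinM -!EFinD !lee_fin => ae ce [] uac.
  by congr (_%:E); apply/eqP; rewrite eq_le ae/=; lra.
pose fP : {nonneg R} := NngNum (fine_ge0 (measure_ge0 P E)).
pose Xm : {mfun T >-> m.-tuple R} := HB.pack X (isMeasurableFun.Build _ _ _ _ _ mX).
pose m1 : {measure set (m.-tuple R) -> \bar R} := mscale fP (distribution P Xm).
pose m2 : {measure set (m.-tuple R) -> \bar R} :=
  measure_function_pushforward__canonical__measure_function_Measure (mrestr P mE) mX.
have m21 : forall B, measurable B -> m2 B = m1 B.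
  apply: (measure_unique open_box (fun=> setT)) => //.
  - exact: measurable_tupleE.
  - exact: open_boxI.
  - by move=> _; exact: open_boxT.
  - by rewrite bigcup_const//; exists 0%N.
  - by move=> U oU; rewrite /m1 /m2/= /mscale/= fineK ?fin_num_measure// -boxE.
  - move=> _; rewrite /m2/= /pushforward /mrestr/= preimage_setT setTI.
    by rewrite -ge0_fin_numE// fin_num_measure.
have := m21 A mA.
by rewrite /m1 /m2/= /mscale/= fineK ?fin_num_measure.
Qed.

End independence.

(** * Independence of the last coordinate *)

Lemma measurable_invsqrt (R : realType) :
  measurable_fun setT (fun y : R => (Num.sqrt y)^-1).
Proof.
(* For [y <= 0] both functions are 0, by the conventions for roots, inverses and powers. *)
rewrite (_ : (fun _ => _) = fun y : R => Num.max y 0 `^ (- 2^-1)).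
  apply: (measurableT_comp (f := fun y : R => y `^ (- 2^-1))); first exact: measurable_powR.
  exact: measurable_maxr.
apply/funext => y; have [y0|y0] := leP y 0.
  by rewrite ler0_sqrtr// invr0 powR0// oppr_eq0 invr_eq0.
by rewrite powRN powR12_sqrt// ltW.
Qed.

Section hat_eps.
Context {R : realType} {M : nat}.
Implicit Types s : M.+1.-tuple R.

(** Used as a mirror normal: the reflection along [ext v] fixes the last coordinate and acts on the
    others as the reflection along [v]. *)
Definition ext (v : M.-tuple R) : M.+1.-tuple R := [tuple nth 0 v i | i < M.+1].

Lemma ext_widen v i : tnth (ext v) (widen_ord (leqnSn M) i) = tnth v i.
Proof. by rewrite tnth_mktuple (tnth_nth 0). Qed.

Lemma ext_max v : tnth (ext v) ord_max = 0.
Proof. by rewrite tnth_mktuple nth_default// size_tuple. Qed.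

Lemma dot_ext v s :
  dot (ext v) s = \sum_(i < M) tnth v i * tnth s (widen_ord (leqnSn M) i).
Proof.
rewrite /dot big_ord_recr/= ext_max mul0r addr0.
by apply: eq_bigr => i _; rewrite ext_widen.
Qed.

Lemma eps_refl v s : eps (refl (ext v) s) = eps s.
Proof. by rewrite /eps tnth_mktuple ext_max mulr0 subr0. Qed.

(** The normalizing factor of [hat] is a function of [eps], which this reflection fixes. *)
Lemma hat_refl v s : hat (refl (ext v) s) = refl v (hat s).
Proof.
apply: eq_from_tnth => i; rewrite [RHS]tnth_refl [LHS]tnth_mktuple [in LHS]tnth_refl eps_refl ext_widen
  [X in _ = X - _]tnth_mktuple.
set c := Num.sqrt _.
have -> : dot (ext v) (ext v) = dot v v.
  by rewrite dot_ext; apply: eq_bigr => j _; rewrite ext_widen.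
rewrite (_ : dot v (hat s) = dot (ext v) s / c); last first.
  by rewrite dot_ext mulr_suml; apply: eq_bigr => j _; rewrite /hat tnth_mktuple -/c mulrA.
by rewrite mulrBl; congr (_ - _); ring.
Qed.

Lemma measurable_eps : measurable_fun setT (@eps R M).
Proof. exact: measurable_tnth. Qed.

Lemma measurable_hat : measurable_fun setT (@hat R M).
Proof.
apply/measurable_fun_tnthP => i.
rewrite (_ : _ \o _ = fun s => tnth s (widen_ord (leqnSn M) i) *
    (Num.sqrt ((M.+1%:R - eps s ^+ 2) / M%:R))^-1); last first.
  by apply/funext => s; rewrite /= tnth_mktuple.
apply: measurable_funM; first exact: measurable_tnth.
apply: (measurableT_comp (measurable_invsqrt R)
  (g := fun s => (M.+1%:R - eps s ^+ 2) / M%:R)).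
apply: measurable_funM => //; apply: measurable_funB => //.
by apply: measurable_funX; exact: measurable_eps.
Qed.

Lemma sphere_eps s : sphere M.+1 s ->
  \sum_(i < M) tnth s (widen_ord (leqnSn M) i) ^+ 2 = M.+1%:R - eps s ^+ 2.
Proof. by rewrite /sphere/= big_ord_recr/= => <-; rewrite /eps addrK. Qed.

Lemma sphere_eps_le s : sphere M.+1 s -> eps s ^+ 2 <= M.+1%:R.
Proof.
move=> /sphere_eps H; rewrite -subr_ge0 -H.
by apply: sumr_ge0 => i _; exact: sqr_ge0.
Qed.

Lemma sphere_hat s : (0 < M)%N -> sphere M.+1 s -> eps s ^+ 2 != M.+1%:R ->
  sphere M (hat s).
Proof.
move=> M0 Ss se; rewrite /sphere/=.
have lt : 0 < M.+1%:R - eps s ^+ 2.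
  by rewrite subr_gt0 lt_neqAle se sphere_eps_le.
under eq_bigr => i _ do rewrite tnth_mktuple expr_div_n sqr_sqrtr ?divr_ge0// ?ltW//.
by rewrite -mulr_suml sphere_eps// invf_div mulrCA divff ?mulr1// gt_eqF.
Qed.

Section uniform.
Variable lam : probability (M.+1.-tuple R) R.
Hypothesis ulam : uniform_on_sphere M.+1 lam.
Hypothesis M0 : (0 < M)%N.

Lemma measurable_set1_tuple n (p : n.-tuple R) : measurable [set p].
Proof.
rewrite (_ : [set _] = \bigcap_(i : 'I_n)
    ((fun x : n.-tuple R => tnth x i) @^-1` [set tnth p i])); last first.
  apply/seteqP; split => x /=; first by move=> -> i.
  by move=> xp; apply: eq_from_tnth => i; exact: xp.
apply: fin_bigcap_measurable => // i _.
by rewrite -[X in measurable X]setTI; apply: measurable_tnth.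
Qed.

Lemma sphere_atom p q : sphere M.+1 p -> sphere M.+1 q -> lam [set p] = lam [set q].
Proof.
move=> /sphereE Sp /sphereE Sq.
rewrite -(uniform_on_sphere_refl _ (sub_tuple q p) _ ulam (measurable_set1_tuple _ p)).
congr (lam _); apply/seteqP; split => t /=.
  move=> tp; rewrite -(reflK (sub_tuple q p) t) tp.
  by rewrite -[X in refl _ X](refl_swap q p) ?Sp// reflK.
by move=> ->; rewrite refl_swap// Sp.
Qed.

(** By [sphere_atom] all points of the sphere have equal mass, and for [M >= 1] there are infinitely
    many of them. *)
Lemma sphere_atom0 p : sphere M.+1 p -> lam [set p] = 0%E.
Proof.
move=> Sp; pose c k : R := k.+1%:R^-1.
have c01 k : c k ^+ 2 <= M.+1%:R.
  rewrite (@le_trans _ _ 1) ?ler1n// expr_le1// ?invr_ge0// invf_le1// ler1n.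
  by [].
(* Infinitely many points of the sphere, told apart by their last coordinate [1 / (k + 1)]. *)
pose q k : M.+1.-tuple R := [tuple (if i == ord0 then Num.sqrt (M.+1%:R - c k ^+ 2)
  else if i == ord_max then c k else 0) | i < M.+1].
have max0 : ord_max != ord0 :> 'I_M.+1 by rewrite -val_eqE/= -lt0n.
have qmax k : tnth (q k) ord_max = c k by rewrite tnth_mktuple (negbTE max0) eqxx.
have Sq k : sphere M.+1 (q k).
  rewrite /sphere/= (bigD1 ord0)//= (bigD1 ord_max)//= qmax.
  rewrite tnth_mktuple eqxx sqr_sqrtr ?subr_ge0// big1; first by rewrite addr0 subrK.
  by move=> i /andP[i0 im]; rewrite tnth_mktuple (negbTE i0) (negbTE im) expr0n.
have qinj : injective q.
  move=> i j /(congr1 (fun t => tnth t ord_max)); rewrite !qmax => /invr_inj /eqP.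
  by rewrite eqr_nat eqSS => /eqP.
have tq n : trivIset [set: 'I_n] (fun k : 'I_n => [set q k]).
  move=> i j _ _ [x [/= -> /qinj]]; exact: val_inj.
have pfin : lam [set p] \is a fin_num by rewrite fin_num_measure//; exact: measurable_set1_tuple.
have bound n : n%:R * fine (lam [set p]) <= 1.
  rewrite -lee_fin EFinM fineK//.
  have -> : (n%:R%:E * lam [set p] = lam (\big[setU/set0]_(k < n) [set q k]))%E.
    rewrite measure_bigsetU_ord//.
      rewrite (eq_bigr (fun=> (fine (lam [set p]))%:E)); last first.
        by move=> k _ /=; rewrite fineK//; exact: sphere_atom.
      by rewrite sumEFin sumr_const card_ord -[in LHS](fineK pfin) -EFinM mulr_natl.
    by move=> k; exact: measurable_set1_tuple.
  apply: probability_le1; apply: bigsetU_measurable => k _; exact: measurable_set1_tuple.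
rewrite -(fineK pfin); congr (_%:E); apply/eqP; rewrite eq_le fine_ge0// andbT.
rewrite leNgt; apply/negP => x0; have := bound (Num.bound (fine (lam [set p]))^-1).
rewrite leNgt => /negP; apply.
by rewrite -ltr_pdivrMr// mul1r archi_boundP// invr_ge0 ltW.
Qed.

Lemma measurable_eps_sqr (c : R) : measurable [set s : M.+1.-tuple R | eps s ^+ 2 = c].
Proof.
have := @measurable_funX _ _ R setT (@eps R M) 2 measurable_eps.
by move=> /(_ measurableT [set c] (measurable_set1 _)); rewrite setTI.
Qed.

(** Within the sphere this event consists of the two poles, where [hat] divides by 0 and takes the
    value 0, off the smaller sphere. *)
Lemma eps_sqr_neq : lam [set s : M.+1.-tuple R | eps s ^+ 2 = M.+1%:R] = 0%E.
Proof.
pose p (b : bool) : M.+1.-tuple R :=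
  [tuple if i == ord_max then (-1) ^+ b * Num.sqrt M.+1%:R else 0 | i < M.+1].
have Sp b : sphere M.+1 (p b).
  rewrite /sphere/= (bigD1 ord_max)//= tnth_mktuple eqxx exprMn sqrr_sign mul1r.
  rewrite sqr_sqrtr// big1 ?addr0// => i im.
  by rewrite tnth_mktuple (negbTE im) expr0n.
have mE := measurable_eps_sqr M.+1%:R.
have lS : lam (~` sphere M.+1) = 0%E.
  by case: ulam => lS _; rewrite probability_setC ?lS ?subee//; exact: measurable_sphere.
have mp b : measurable [set p b] by exact: measurable_set1_tuple.
apply: (@subset_measure0 _ _ _ lam _ (~` sphere M.+1 `|` ([set p true] `|` [set p false]))) => //.
- apply: measurableU; first by apply: measurableC; exact: measurable_sphere.
  exact: measurableU.
- move=> s /= es; have [Ss|] := pselect (sphere M.+1 s); [right|by left].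
  have s0 i : i != ord_max -> tnth s i = 0.
    move=> im; have := sphere_eps _ Ss; rewrite es subrr => /eqP.
    rewrite psumr_eq0; last by move=> j _; exact: sqr_ge0.
    have iM : (i < M)%N by rewrite ltn_neqAle -ltnS ltn_ord andbT; exact: im.
    move=> /allP/(_ (Ordinal iM) (mem_index_enum _)); rewrite sqrf_eq0 => /eqP.
    by move=> <-; congr tnth; exact: val_inj.
  have [e0|e0] := leP 0 (eps s); [right|left]; apply: eq_from_tnth => i;
    rewrite tnth_mktuple; (case: eqVneq => [->|]; last exact: s0); rewrite -/(eps s).
    by rewrite mul1r -es sqrtr_sqr ger0_norm.
  by rewrite mulN1r -es sqrtr_sqr ltr0_norm// opprK.
- apply/eqP; rewrite eq_le measure_ge0 andbT.
  apply: (le_trans (measureU2 _ _ _)) => //.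
  + by apply: measurableC; exact: measurable_sphere.
  + exact: measurableU.
  rewrite /= lS add0e; apply: (le_trans (measureU2 _ _ _)) => //.
  by rewrite /= !sphere_atom0// adde0.
Qed.

Lemma hat_sphere_prob : lam (@hat R M @^-1` sphere M) = 1%E.
Proof.
have mS : measurable (@hat R M @^-1` sphere M).
  by rewrite -[X in measurable X]setTI; apply: measurable_hat => //; exact: measurable_sphere.
have : lam (~` (@hat R M @^-1` sphere M)) = 0%E.
  apply: (@subset_measure0 _ _ _ lam _ (~` sphere M.+1 `|` [set s | eps s ^+ 2 = M.+1%:R])).
  - exact: measurableC.
  - apply: measurableU; first by apply: measurableC; exact: measurable_sphere.
    exact: (measurable_eps_sqr M.+1%:R).
  - move=> s /= nS; have [Ss|] := pselect (sphere M.+1 s); [right|by left].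
    by apply/eqP/negPn/negP => es; apply: nS; exact: sphere_hat.
  - apply/eqP; rewrite eq_le measure_ge0 andbT.
    apply: (le_trans (measureU2 _ _ _)) => //.
    + by apply: measurableC; exact: measurable_sphere.
    + exact: (measurable_eps_sqr M.+1%:R).
    rewrite /= eps_sqr_neq adde0 probability_setC; last exact: measurable_sphere.
    by case: ulam => -> _; rewrite subee.
by rewrite probability_setC// => /eqP; rewrite sube_eq// ?add0e ?fin_num_measure// => /eqP.
Qed.

(** Reflections along [ext v] preserve [lam], fix [eps] and reflect [hat], so every event about
    [eps] satisfies [refl_invariant]. *)
Lemma hat_eps_indep A B : measurable A -> measurable B ->
  lam (@hat R M @^-1` A `&` @eps R M @^-1` B) =
  (lam (@hat R M @^-1` A) * lam (@eps R M @^-1` B))%E.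
Proof.
move=> mA mB; rewrite muleC.
have inv E : measurable E -> refl_invariant lam hat (@eps R M @^-1` E).
  move=> mE v C mC; rewrite -[RHS](uniform_on_sphere_refl _ (ext v) _ ulam).
    by congr (lam _); apply/seteqP; split => s /=; rewrite hat_refl eps_refl.
  apply: measurableI; rewrite -[X in measurable X]setTI; first exact: measurable_hat.
  exact: measurable_eps.
apply: refl_invariant_indep => //.
- exact: measurable_hat.
- exact: hat_sphere_prob.
- by rewrite -[X in measurable X]setTI; exact: measurable_eps.
- exact: inv.
- by rewrite -(preimage_setT (@eps R M)); exact: inv.
Qed.

End uniform.
End hat_eps.

(** * Consequences of the moment recursion *)

Section moment_system.
Context {R : realType}.
Variable b : R.
Hypothesis b_ge0 : 0 <= b.

(* The relations satisfied by the Gibbs moments [r k] of [eps]: the recursion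
   is the integration by parts on the sphere, the inequalities only express
   positivity of the expectations of [eps^(2p)], [(M+1 - eps^2) eps^(2p)] and
   of two squares. *)
Record moment_system (M : nat) (a : R) (r : nat -> R) : Prop := {
  ms_r0 : r 0%N = 1;
  ms_r1 : M%:R * r 1%N =
    M.+1%:R * (a * r 0%N - b * r 1%N) - (a * r 2%N - b * r 3%N);
  ms_rSS : forall j, M%:R * r j.+2 =
    M.+1%:R * (j.+1%:R * r j + a * r j.+1 - b * r j.+2)
    - (j.+1%:R * r j.+2 + a * r j.+3 - b * r j.+4);
  ms_even_ge0 : forall p, 0 <= r p.*2;
  ms_even_le : forall p, r p.*2.+2 <= M.+1%:R * r p.*2;
  ms_amgm : forall p, a * (M.+1%:R * r p.*2.+1 - r p.*2.+3) <=
    2^-1 * (2^-1 * (M.+1%:R * r p.*2.+2 - r p.*2.+4)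
            + 2 * a ^+ 2 * (M.+1%:R * r p.*2 - r p.*2.+2));
  ms_abs : forall k, `|r k| <= 1 + r k.*2 }.

Lemma even_moment_step M a r p : (0 < M)%N -> moment_system M a r ->
  r p.*2.+2 <= 4 * (p.*2.+1%:R + a ^+ 2) * r p.*2.
Proof.
move=> M0 ms; have M1 : 1 <= M%:R :> R by rewrite ler1n.
have := ms_rSS _ _ _ ms p.*2; have := ms_amgm _ _ _ ms p.
have := ms_even_le _ _ _ ms p.+1; have := ms_even_le _ _ _ ms p.
have := ms_even_ge0 _ _ _ ms p; have := ms_even_ge0 _ _ _ ms p.+1.
have := ms_even_ge0 _ _ _ ms p.+2.
rewrite !doubleS -[M.+1%:R]natr1.
move: (r p.*2) (r p.*2.+1) (r p.*2.+2) (r p.*2.+3) (r p.*2.+4) => r0 r1 r2 r3 r4.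
have : 0 <= p.*2.+1%:R :> R by [].
move: (p.*2.+1%:R) (M%:R : R) M1 => u m m1 u0 r40 r20 r00 le02 le24 amgm rec.
have H : m * r2 <= (m + 1) * (u * r0) + 2^-1 * (2^-1 * ((m + 1) * r2)) + a ^+ 2 * ((m + 1) * r0).
  have : 0 <= b * ((m + 1) * r2 - r4) by rewrite mulr_ge0// subr_ge0.
  have : 0 <= a ^+ 2 * r2 by rewrite mulr_ge0// sqr_ge0.
  have : 0 <= u * r2 by rewrite mulr_ge0.
  lra.
have K0 : 0 <= (u + a ^+ 2) * r0 by rewrite mulr_ge0// addr_ge0// sqr_ge0.
(* With [m + 1 <= 2 m], the quarter becomes at most half of the left side; moving it over doubles
   the factor 2 of the other terms to 4. *)
have : m * r2 <= m * (4 * (u + a ^+ 2) * r0) by nra.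
by rewrite ler_pM2l//; lra.
Qed.

(** [C] and [s] are chosen before [M], [a] and [r]: uniformity in [M] yields the final constant, and
    polynomial growth in [a] is harmless under the Gaussian mean. *)
Definition poly_bounded (f : nat -> R -> (nat -> R) -> R) := exists C s,
  forall M a r, (0 < M)%N -> moment_system M a r ->
    `|f M a r| <= C * (1 + a ^+ 2) ^+ s.

Lemma one_le_1D_sqr (a : R) : 1 <= 1 + a ^+ 2.
Proof. by rewrite lerDl sqr_ge0. Qed.

Lemma poly_boundedW f g : poly_bounded f ->
  (forall M a r, (0 < M)%N -> moment_system M a r ->
    `|g M a r| <= `|f M a r|) -> poly_bounded g.
Proof.
move=> [C [s H]] fg; exists C, s => M a r M0 ms.
exact: le_trans (fg _ _ _ M0 ms) (H _ _ _ M0 ms).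
Qed.

Lemma poly_bounded_eq f g : poly_bounded f ->
  (forall M a r, (0 < M)%N -> moment_system M a r -> g M a r = f M a r) ->
  poly_bounded g.
Proof.
by move=> pf fg; apply: poly_boundedW pf _ => M a r M0 ms; rewrite (fg _ _ _ M0 ms).
Qed.

Lemma poly_bounded_cst c : poly_bounded (fun _ _ _ => c).
Proof. by exists `|c|, 0%N => M a r _ _; rewrite expr0 mulr1. Qed.

Lemma poly_bounded_a : poly_bounded (fun _ a _ => a).
Proof.
exists 1, 1%N => M a r _ _; rewrite expr1 mul1r ler_norml.
by have := sqr_ge0 (a - 1); have := sqr_ge0 (a + 1); rewrite !expr2; nra.
Qed.

Lemma poly_boundedD f g : poly_bounded f -> poly_bounded g ->
  poly_bounded (fun M a r => f M a r + g M a r).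
Proof.
move=> [C [s Hf]] [D [t Hg]]; exists (`|C| + `|D|), (s + t)%N => M a r M0 ms.
have A1 := one_le_1D_sqr a.
have grow (c : R) u v : (u <= v)%N -> c * (1 + a ^+ 2) ^+ u <= `|c| * (1 + a ^+ 2) ^+ v.
  move=> uv; apply: (@le_trans _ _ (`|c| * (1 + a ^+ 2) ^+ u)).
    by rewrite ler_wpM2r ?ler_norm// exprn_ge0// (le_trans ler01).
  by rewrite ler_wpM2l// ler_weXn2l.
rewrite (le_trans (ler_normD _ _))// mulrDl lerD//.
  by rewrite (le_trans (Hf _ _ _ M0 ms))// grow// leq_addr.
by rewrite (le_trans (Hg _ _ _ M0 ms))// grow// leq_addl.
Qed.

Lemma poly_boundedM f g : poly_bounded f -> poly_bounded g ->
  poly_bounded (fun M a r => f M a r * g M a r).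
Proof.
move=> [C [s Hf]] [D [t Hg]]; exists (C * D), (s + t)%N => M a r M0 ms.
by rewrite normrM exprD mulrACA ler_pM ?Hf ?Hg.
Qed.

Lemma poly_boundedN f : poly_bounded f -> poly_bounded (fun M a r => - f M a r).
Proof. by move=> [C [s H]]; exists C, s => M a r M0 ms; rewrite normrN H. Qed.

Lemma poly_bounded_even p : poly_bounded (fun _ _ r => r p.*2).
Proof.
elim: p => [|p IHp].
  by apply: poly_boundedW (poly_bounded_cst 1) _ => M a r _ /ms_r0 ->.
have pbB : poly_bounded (fun _ a _ => 4 * (p.*2.+1%:R + a * a)).
  apply: poly_boundedM; first exact: poly_bounded_cst.
  apply: poly_boundedD; first exact: poly_bounded_cst.
  by apply: poly_boundedM; exact: poly_bounded_a.
apply: (poly_boundedW _ _ (poly_boundedM _ _ pbB IHp)) => M a r M0 ms.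
rewrite ger0_norm; last exact: ms_even_ge0 ms p.+1.
apply: le_trans (ler_norm _).
by have := even_moment_step _ _ _ p M0 ms; rewrite -expr2 doubleS.
Qed.

Lemma poly_bounded_moment k : poly_bounded (fun _ _ r => r k).
Proof.
apply: (poly_boundedW _ _ (poly_boundedD _ _ (poly_bounded_cst 1) (poly_bounded_even k))).
move=> M a r M0 ms; rewrite (le_trans (ms_abs _ _ _ ms k))//.
by apply: le_trans (ler_norm _).
Qed.

Lemma gamma_seqSS (a : R) k : gamma_seq a b k.+2 =
  a / (b + 1) * gamma_seq a b k.+1 + k.+1%:R / (b + 1) * gamma_seq a b k.
Proof. by []. Qed.

Lemma poly_bounded_gamma k : poly_bounded (fun _ a _ => gamma_seq a b k).
Proof.
have pba c : poly_bounded (fun _ a _ => a / c).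
  by apply: poly_boundedM; [exact: poly_bounded_a|exact: poly_bounded_cst].
suff : poly_bounded (fun _ a _ => gamma_seq a b k) /\
  poly_bounded (fun _ a _ => gamma_seq a b k.+1) by case.
elim: k => [|k [IH1 IH2]]; first by split; [exact: poly_bounded_cst|exact: pba].
split=> //; apply: poly_boundedD; apply: poly_boundedM => //.
exact: poly_bounded_cst.
Qed.

(** The part of [ms_rSS] of order [M] is [b + 1] times the recursion of [gamma_seq]. Subtracting
    leaves the two previous errors and moments with coefficients free of [M], which
    [poly_bounded_moment] controls at every order. *)
Lemma moment_error k :
  poly_bounded (fun M a r => M%:R * (r k - gamma_seq a b k)).
Proof.
have b1 : 0 < b + 1 by rewrite ltr_wpDl.
have b1n : b + 1 != 0 by rewrite gt_eqF.
have pba := poly_bounded_a; have pbr := poly_bounded_moment.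
have pbc := poly_bounded_cst.
suff : poly_bounded (fun M a r => M%:R * (r k - gamma_seq a b k)) /\
  poly_bounded (fun M a r => M%:R * (r k.+1 - gamma_seq a b k.+1)) by case.
elim: k => [|k [IH1 IH2]]; split => //.
- apply: (poly_boundedW _ _ (poly_bounded_cst 0)) => M a r _ ms.
  by rewrite (ms_r0 _ _ _ ms) subrr mulr0.
- have pbE : poly_bounded (fun M a r => (b + 1)^-1 *
      (a * r 0%N + (- b) * r 1%N + (- (a * r 2%N) + b * r 3%N))).
    by do ![exact: pbc|exact: pba|exact: pbr|apply: poly_boundedN|
      apply: poly_boundedM|apply: poly_boundedD].
  apply: (poly_bounded_eq _ _ pbE) => M a r M0 ms.
  have := ms_r1 _ _ _ ms; rewrite (ms_r0 _ _ _ ms) -[M.+1%:R]natr1 => E.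
  apply: (mulfI b1n); rewrite mulVKf// /gamma_seq/=.
  transitivity (M%:R * (b * r 1%N + r 1%N - a)); first by field.
  lra.
- have pbE : poly_bounded (fun M a r => (b + 1)^-1 *
      (a * (M%:R * (r k.+1 - gamma_seq a b k.+1))
       + k.+1%:R * (M%:R * (r k - gamma_seq a b k))
       + (k.+1%:R * r k + a * r k.+1 + (- b) * r k.+2
          + (- (k.+1%:R * r k.+2) + (- (a * r k.+3)) + b * r k.+4)))).
    by do ![exact: pbc|exact: pba|exact: pbr|exact: IH1|exact: IH2|
      apply: poly_boundedN|apply: poly_boundedM|apply: poly_boundedD].
  apply: (poly_bounded_eq _ _ pbE) => M a r M0 ms.
  have := ms_rSS _ _ _ ms k; rewrite -[M.+1%:R]natr1 => E.
  apply: (mulfI b1n); rewrite mulVKf// gamma_seqSS.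
  transitivity (M%:R * (b * r k.+2 + r k.+2 - a * gamma_seq a b k.+1
    - k.+1%:R * gamma_seq a b k)); first by field.
  lra.
Qed.

Lemma poly_bounded_prod_gamma (ks : seq nat) :
  poly_bounded (fun _ a _ => \prod_(k <- ks) gamma_seq a b k).
Proof.
elim: ks => [|j l IHl].
  by apply: (poly_bounded_eq _ _ (poly_bounded_cst 1)) => M a r _ _; rewrite big_nil.
apply: (poly_bounded_eq _ _ (poly_boundedM _ _ (poly_bounded_gamma j) IHl)).
by move=> M a r _ _; rewrite big_cons.
Qed.

(** Telescoping: replace the first factor, whose error meets a product of gammas, then the remaining
    ones. *)
Lemma product_error (ks : seq nat) : poly_bounded (fun M a r =>
  M%:R * (\prod_(k <- ks) r k - \prod_(k <- ks) gamma_seq a b k)).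
Proof.
elim: ks => [|k ks IH].
  apply: (poly_boundedW _ _ (poly_bounded_cst 0)) => M a r _ _.
  by rewrite !big_nil subrr mulr0.
have := poly_boundedD _ _ (poly_boundedM _ _ (moment_error k) (poly_bounded_prod_gamma ks))
  (poly_boundedM _ _ (poly_bounded_moment k) IH).
move=> /poly_bounded_eq; apply => M a r _ _; rewrite !big_cons.
by ring.
Qed.

End moment_system.

(** * Integration by parts on the sphere *)

Section uniform_integrals.
Context {R : realType} {n : nat}.
Variable lam : probability (n.-tuple R) R.
Hypothesis ulam : uniform_on_sphere n lam.

Lemma uniform_sphereC : lam (~` sphere n) = 0%E.
Proof.
by case: ulam => lS _; rewrite probability_setC ?lS ?subee//; exact: measurable_sphere.
Qed.

Lemma integrable_sphere (f : n.-tuple R -> R) C : measurable_fun setT f ->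
  (forall s, sphere n s -> `|f s| <= C) -> lam.-integrable setT (EFin \o f).
Proof.
move=> mf fC; have mS : measurable (sphere n : set (n.-tuple R)) := measurable_sphere.
apply/integrableP; split; first exact/measurable_EFinP.
rewrite (@ge0_negligible_integral _ _ _ _ _ (~` sphere n))//; last 3 first.
- exact: measurableC.
- by apply: measurableT_comp => //; exact/measurable_EFinP.
- exact: uniform_sphereC.
(* Only the sphere carries mass, so a bound on the sphere is enough. *)
rewrite setTD setCK; apply: (@le_lt_trans _ _ (\int[lam]_(x in sphere n) (`|C|)%:E)%E).
  apply: ge0_le_integral => //.
  - by apply: measurable_funTS; apply: measurableT_comp => //; exact/measurable_EFinP.
  - by move=> s Ss; rewrite /= lee_fin (le_trans (fC s Ss))// ler_norm.
by rewrite integral_cst// lte_mul_pinfty// ?lee_fin//= -ge0_fin_numE ?fin_num_measure.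
Qed.

Lemma Rintegral_sphere (f : n.-tuple R -> R) : lam.-integrable setT (EFin \o f) ->
  \int[lam]_(s in sphere n) f s = \int[lam]_s f s.
Proof.
move=> intf; rewrite /Rintegral; congr fine.
rewrite [RHS](@negligible_integral _ _ _ _ _ (~` sphere n))//.
- by rewrite setTD setCK.
- by apply: measurableC; exact: measurable_sphere.
- exact: uniform_sphereC.
Qed.

Lemma Rintegral_refl (f : n.-tuple R -> R) v : measurable_fun setT f ->
  lam.-integrable setT (EFin \o (f \o refl v)) ->
  \int[lam]_s f (refl v s) = \int[lam]_s f s.
Proof.
move=> mf intf; rewrite /Rintegral; congr fine.
have mEf : measurable_fun setT (EFin \o f) by exact/measurable_EFinP.
have := integral_pushforward (measurable_refl v) mEf intf measurableT.
rewrite preimage_setT => /esym ->; apply: eq_measure_integral; first exact: measurable_refl.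
by move=> mr A mA _; exact: (uniform_on_sphere_refl lam v A ulam mA).
Qed.

Lemma dot_refl_refl v (s : n.-tuple R) : dot (refl v s) (refl v s) = dot s s.
Proof. by rewrite dot_refl reflK. Qed.

Lemma sphere_refl v (s : n.-tuple R) : sphere n s -> sphere n (refl v s).
Proof. by move=> /sphereE Ss; apply/sphereE; rewrite dot_refl_refl. Qed.

Lemma sphere_coord (s : n.-tuple R) i : sphere n s -> `|tnth s i| <= Num.sqrt n%:R.
Proof.
rewrite /sphere/= => Ss; rewrite -sqrtr_sqr ler_sqrt// -Ss (bigD1 i)//= lerDl.
by apply: sumr_ge0 => j _; exact: sqr_ge0.
Qed.

End uniform_integrals.

Lemma continuous_bounded_itv {R : realType} (g : R -> R) K : continuous g ->
  exists C, forall x, `|x| <= K -> `|g x| <= C.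
Proof.
move=> cg; have [K0|K0] := ltP K 0.
  by exists 0 => x xK; have := le_lt_trans xK K0; rewrite normr_lt0.
have KK : - K <= K by rewrite (le_trans _ K0)// oppr_le0.
have cng : {within `[- K, K], continuous (fun x => `|g x|)}.
  apply: continuous_subspaceT => x; apply: continuous_comp; first exact: cg.
  exact: norm_continuous.
have [c _ gc] := EVT_max KK cng.
by exists `|g c| => x xK; apply: gc; rewrite in_itv/= -ler_norml.
Qed.

Section stein.
Context {R : realType} {M : nat}.
Variable lam : probability (M.+1.-tuple R) R.
Hypothesis ulam : uniform_on_sphere M.+1 lam.
Variables g dg : R -> R.
Hypothesis gdg : forall x : R, is_derive x 1 g (dg x).
Hypothesis cdg : continuous dg.

Let cg : continuous g.
Proof.
by move=> x; apply/differentiable_continuous/derivable1_diffP; exact: ex_derive.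
Qed.

Section coordinate.
Variable i : 'I_M.
Let j := widen_ord (leqnSn M) i.
(** [x t] and [y t] are coordinate [j] and the last coordinate after the reflection along [axis t].
    A reflection doubles angles, hence the half angles in [axis]. *)
Let x (t : R) (s : M.+1.-tuple R) := cos t * tnth s j + sin t * eps s.
Let y (t : R) (s : M.+1.-tuple R) := sin t * tnth s j - cos t * eps s.
Let F t s := x t s * g (y t s).
Let dF t s := - (y t s * g (y t s)) + x t s ^+ 2 * dg (y t s).
Let axis (t : R) : M.+1.-tuple R :=
  [tuple if k == j then - sin (t / 2) else if k == ord_max then cos (t / 2) else 0 | k < M.+1].

Let jmax : (ord_max == j) = false.
Proof. by apply/negbTE; rewrite -val_eqE/= neq_ltn ltn_ord orbT. Qed.

Let dot_axis t s : dot (axis t) s = - sin (t / 2) * tnth s j + cos (t / 2) * eps s.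
Proof.
rewrite /dot (bigD1 j)//= (bigD1 ord_max) ?jmax//= !tnth_mktuple eqxx jmax eqxx.
rewrite big1 ?addr0// => k /andP[kj km].
by rewrite tnth_mktuple (negbTE kj) (negbTE km) mul0r.
Qed.

Let refl_axis t s : tnth (refl (axis t) s) j = x t s /\ eps (refl (axis t) s) = y t s.
Proof.
have ax1 : dot (axis t) (axis t) = 1.
  rewrite dot_axis /eps !tnth_mktuple eqxx jmax eqxx -[RHS](cos2Dsin2 (t / 2)); ring.
have tE : t = t / 2 + t / 2 by field.
have ct : cos t = cos (t / 2) ^+ 2 - sin (t / 2) ^+ 2 by rewrite {1}tE cosD; ring.
have st : sin t = 2 * sin (t / 2) * cos (t / 2) by rewrite {1}tE sinD; ring.
have := cos2Dsin2 (t / 2); rewrite /eps !tnth_refl ax1 dot_axis !tnth_mktuple.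
rewrite !eqxx jmax /x /y ct st -/(eps s).
move: (cos _) (sin _) => c z cz; split.
  transitivity ((c ^+ 2 + z ^+ 2) * tnth s j - 2 * (- z * tnth s j + c * eps s) * - z).
    by rewrite cz; field.
  ring.
transitivity ((c ^+ 2 + z ^+ 2) * eps s - 2 * (- z * tnth s j + c * eps s) * c).
  by rewrite cz /eps; field.
ring.
Qed.

Let mx t : measurable_fun setT (x t).
Proof.
by apply: measurable_funD; apply: measurable_funM => //; exact: measurable_tnth.
Qed.

Let my t : measurable_fun setT (y t).
Proof.
by apply: measurable_funB; apply: measurable_funM => //; exact: measurable_tnth.
Qed.

Let mcomp (f : R -> R) t : continuous f -> measurable_fun setT (f \o y t).
Proof.
by move=> cf; apply: measurableT_comp => //; exact: continuous_measurable_fun.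
Qed.

Let bound_xy t s : sphere M.+1 s ->
  `|x t s| <= Num.sqrt M.+1%:R /\ `|y t s| <= Num.sqrt M.+1%:R.
Proof.
move=> Ss; have [<- <-] := refl_axis t s.
by split; apply: sphere_coord; exact: sphere_refl.
Qed.

Let is_derive_F (t : R) s : is_derive t 1 (F ^~ s) (dF t s).
Proof.
have dx : is_derive t 1 (x ^~ s) (- y t s).
  by apply: is_derive_eq; rewrite /y /GRing.scale/=; ring.
have dy : is_derive t 1 (y ^~ s) (x t s).
  by apply: is_derive_eq; rewrite /x /GRing.scale/=; ring.
have dgy := @is_derive1_comp R g (y ^~ s) t _ _ (gdg (y t s)) dy.
have dxg := is_deriveM dx dgy.
apply: (is_derive_eq dxg).
by rewrite /dF /GRing.scale/=; ring.
Qed.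

(** By invariance the integral of [F t] does not depend on [t], so that of its derivative vanishes.
    As [x' = - y] and [y' = x], the derivative is [- y g(y) + x^2 g'(y)]. *)
Lemma stein_coord :
  \int[lam]_s (eps s * g (eps s)) = \int[lam]_s (tnth s j ^+ 2 * dg (eps s)).
Proof.
pose K : R := Num.sqrt M.+1%:R.
have [Cg gC] := continuous_bounded_itv g K cg.
have [Cd dC] := continuous_bounded_itv dg K cdg.
have K0 : 0 <= K by exact: sqrtr_ge0.
have mF t : measurable_fun setT (F t).
  by apply: measurable_funM => //; exact: mcomp.
have mdF t : measurable_fun setT (dF t).
  apply: measurable_funD.
    by apply: measurableT_comp => //; apply: measurable_funM => //; exact: mcomp.
  apply: measurable_funM; first exact: measurable_funX.
  exact: mcomp.
have bdF t s : sphere M.+1 s -> `|dF t s| <= K * Cg + K * K * Cd.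
  move=> Ss; have [xK yK] := bound_xy t s Ss.
  rewrite /dF (le_trans (ler_normD _ _))// normrN expr2 !normrM lerD//.
    by rewrite ler_pM// gC.
  by rewrite ler_pM ?mulr_ge0// ?dC// ler_pM.
have intF t : lam.-integrable setT (EFin \o F t).
  apply: (integrable_sphere lam ulam _ (K * Cg)) => // s Ss.
  have [xK yK] := bound_xy t s Ss.
  by rewrite /F normrM ler_pM// gC.
have intdF t : lam.-integrable setT (EFin \o dF t).
  by apply: (integrable_sphere lam ulam _ (K * Cg + K * K * Cd)) => // s; exact: bdF.
have mS : measurable (sphere M.+1 : set (M.+1.-tuple R)) := measurable_sphere.
have intS f : lam.-integrable setT (EFin \o f) -> lam.-integrable (sphere M.+1) (EFin \o f).
  by move=> intf; apply: integrableS intf.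
pose f0 (s : M.+1.-tuple R) := tnth s j * g (eps s).
have mge : measurable_fun setT (fun s : M.+1.-tuple R => g (eps s)).
  apply: (measurableT_comp (continuous_measurable_fun cg)); exact: measurable_eps.
have mdge : measurable_fun setT (fun s : M.+1.-tuple R => dg (eps s)).
  apply: (measurableT_comp (continuous_measurable_fun cdg)); exact: measurable_eps.
have EF t : \int[lam]_(s in sphere M.+1) F t s = \int[lam]_s f0 s.
  rewrite Rintegral_sphere//.
  have FE : F t = f0 \o refl (axis t).
    by apply/funext => s; rewrite /f0/=; have [-> ->] := refl_axis t s.
  rewrite FE; apply: Rintegral_refl => //.
    by apply: measurable_funM => //; exact: measurable_tnth.
  by rewrite -FE.
have I0 : `]-1, 1[%classic (0 : R) by rewrite /= in_itv/= ltrN10 ltr01.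
have intFS t : `]-1, 1[%classic t -> lam.-integrable (sphere M.+1) (EFin \o F t).
  by move=> _; exact: intS.
have drF t s : `]-1, 1[%classic t -> sphere M.+1 s -> derivable (F ^~ s) t 1.
  by move=> _ _; exact: (@ex_derive _ _ _ _ _ _ _ (is_derive_F t s)).
(* The dominating constant is valid on the sphere only, so the differentiation takes place under the
   integral over the sphere. *)
have intG : lam.-integrable (sphere M.+1) (EFin \o cst `|K * Cg + K * K * Cd|).
  apply: intS; apply: (integrable_sphere lam ulam _ `|K * Cg + K * K * Cd|) => // s _.
  by rewrite normr_id.
have ubG t s : `]-1, 1[%classic t -> sphere M.+1 s ->
    `|partial1of2 F t s| <= cst `|K * Cg + K * K * Cd| s.
  move=> _ Ss; rewrite partial1of2E (@derive_val _ _ _ _ _ _ _ (is_derive_F t s)).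
  by rewrite (le_trans (bdF t s Ss))// ler_norm.
have H := differentiation_under_integral mS I0 intFS drF (fun=> normr_ge0 _) intG ubG.
have {}H : 0 = \int[lam]_(s in sphere M.+1) dF 0 s.
  rewrite (_ : (fun t => _) = cst (\int[lam]_s f0 s)) in H; last first.
    by apply/funext => t; exact: EF.
  rewrite derive1_cst in H; rewrite [LHS]H; apply: eq_Rintegral => s _.
  by rewrite partial1of2E (@derive_val _ _ _ _ _ _ _ (is_derive_F 0 s)).
pose h0 (s : M.+1.-tuple R) := - (eps s * g (eps s)) + tnth s j ^+ 2 * dg (eps s).
(* At [t = 0] the reflection changes the sign of [eps]; a second use of invariance turns
   [y 0 = - eps] back into [eps]. *)
have dFE : dF 0 = h0 \o refl (axis 0).
  by apply/funext => s; rewrite /h0/=; have [-> ->] := refl_axis 0 s.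
have mepsg : measurable_fun setT (fun s : M.+1.-tuple R => eps s * g (eps s)).
  by apply: measurable_funM => //; exact: measurable_eps.
have mjdg : measurable_fun setT (fun s : M.+1.-tuple R => tnth s j ^+ 2 * dg (eps s)).
  by apply: measurable_funM => //; apply: measurable_funX; exact: measurable_tnth.
move: H; rewrite Rintegral_sphere// dFE Rintegral_refl//; last 2 first.
- by apply: measurable_funD => //; exact: measurableT_comp.
- by rewrite -dFE.
have int1 : lam.-integrable setT (EFin \o (fun s => eps s * g (eps s))).
  apply: (integrable_sphere lam ulam _ (K * Cg)) => // s Ss.
  by rewrite normrM ler_pM// ?gC//; exact: sphere_coord.
have int2 : lam.-integrable setT (EFin \o (fun s => tnth s j ^+ 2 * dg (eps s))).
  apply: (integrable_sphere lam ulam _ (K * K * Cd)) => // s Ss.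
  rewrite expr2 !normrM ler_pM ?mulr_ge0// ?dC//; last exact: sphere_coord.
  by rewrite ler_pM//; exact: sphere_coord.
move=> H; apply/esym/eqP; rewrite -subr_eq0 -RintegralB// H; apply/eqP.
by apply: eq_Rintegral => s _; rewrite /h0 addrC.
Qed.

End coordinate.

(** Sum of [stein_coord] over the first [M] coordinates, whose squares add up to [M + 1 - eps^2] on
    the sphere. *)
Lemma stein :
  M%:R * \int[lam]_s (eps s * g (eps s)) =
  \int[lam]_s ((M.+1%:R - eps s ^+ 2) * dg (eps s)).
Proof.
pose K : R := Num.sqrt M.+1%:R.
have [Cd dC] := continuous_bounded_itv dg K cdg.
have mdge : measurable_fun setT (fun s : M.+1.-tuple R => dg (eps s)).
  apply: (measurableT_comp (continuous_measurable_fun cdg)); exact: measurable_eps.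
pose f i (s : M.+1.-tuple R) := tnth s (widen_ord (leqnSn M) i) ^+ 2 * dg (eps s).
have mf i : measurable_fun setT (f i).
  by apply: measurable_funM => //; apply: measurable_funX; exact: measurable_tnth.
have bf i s : sphere M.+1 s -> `|f i s| <= K * K * Cd.
  move=> Ss; rewrite /f expr2 !normrM ler_pM ?mulr_ge0// ?dC//; last exact: sphere_coord.
  by rewrite ler_pM//; exact: sphere_coord.
have intf i : lam.-integrable setT (EFin \o f i).
  by apply: (integrable_sphere lam ulam _ (K * K * Cd)) => // s; exact: bf.
have sumf (l : seq 'I_M) :
    lam.-integrable setT (EFin \o (fun s => \sum_(i <- l) f i s)) /\
    \int[lam]_s (\sum_(i <- l) f i s) = \sum_(i <- l) \int[lam]_s f i s.
  elim: l => [|i l [IH1 IH2]].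
    rewrite (_ : (fun s => _) = cst 0); last by apply/funext => s; rewrite big_nil.
    by rewrite big_nil Rintegral_cst// mul0r; split => //; exact: integrable0.
  rewrite (_ : (fun s => _) = (fun s => f i s + \sum_(i <- l) f i s)); last first.
    by apply/funext => s; rewrite big_cons.
  split; last by rewrite big_cons RintegralD// IH2.
  exact: (integrableD measurableT (intf i) IH1).
have [intsum sumE] := sumf (index_enum 'I_M).
transitivity (\int[lam]_s \sum_i f i s).
  rewrite sumE (eq_bigr (fun=> \int[lam]_s (eps s * g (eps s)))); last first.
    by move=> i _; exact/esym/stein_coord.
  by rewrite sumr_const card_ord mulr_natl.
rewrite -(Rintegral_sphere lam ulam)//.
have fE s : sphere M.+1 s -> \sum_i f i s = (M.+1%:R - eps s ^+ 2) * dg (eps s).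
  by move=> Ss; rewrite -mulr_suml sphere_eps.
rewrite -[RHS](Rintegral_sphere lam ulam).
  by apply: eq_Rintegral => s /set_mem Ss; exact: fE.
apply: (integrable_sphere lam ulam _ (\sum_(i < M) K * K * Cd)).
  apply: measurable_funM => //; apply: measurable_funB => //.
  by apply: measurable_funX; exact: measurable_eps.
move=> s Ss; rewrite -fE// (le_trans (ler_norm_sum _ _ _))// ler_sum// => i _.
exact: bf.
Qed.

End stein.

(** * Tilted moments *)

Section tilted_moments.
Context {R : realType} {M : nat}.
Variable lam : probability (M.+1.-tuple R) R.
Hypothesis ulam : uniform_on_sphere M.+1 lam.
Variables a b : R.

Definition tilt (x : R) : R := expR (x * a - 2^-1 * x ^+ 2 * b).

(** A linear functional on polynomials: relations between moments become polynomial identities, and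
    moment inequalities become positivity on [x^2 <= M + 1]. *)
Definition tilt_int (p : {poly R}) : R := \int[lam]_s (p.[eps s] * tilt (eps s)).

Lemma is_derive_tilt (x : R) : is_derive x 1 tilt ((a - b * x) * tilt x).
Proof.
have d1 : is_derive x 1 (fun x : R => x * a - 2^-1 * x ^+ 2 * b) (a - b * x).
  by apply: is_derive_eq; rewrite /GRing.scale/=; field.
have := @is_derive1_comp R expR _ x _ _ (is_derive_expR _) d1.
by move=> /is_derive_eq; apply; rewrite mulrC.
Qed.

Lemma continuous_tilt : continuous tilt.
Proof.
move=> x; apply/differentiable_continuous/derivable1_diffP.
exact: (@ex_derive _ _ _ _ _ _ _ (is_derive_tilt x)).
Qed.

Lemma is_derive_poly_tilt (p : {poly R}) (x : R) :
  is_derive x 1 (fun x : R => p.[x] * tilt x)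
    ((p^`() + (a%:P - b *: 'X) * p).[x] * tilt x).
Proof.
have dp : is_derive x 1 (horner p) (p^`()).[x].
  by apply: DeriveDef; [exact: derivable_horner|rewrite derivE derive1E].
have := is_deriveM dp (is_derive_tilt x).
by move=> /is_derive_eq; apply; rewrite !hornerE /GRing.scale/=; ring.
Qed.

Lemma continuous_poly_tilt (p : {poly R}) : continuous (fun x : R => p.[x] * tilt x).
Proof.
by move=> x; apply: cvgM; [exact: continuous_horner|exact: continuous_tilt].
Qed.

Lemma integrable_poly_tilt (p : {poly R}) :
  lam.-integrable setT (EFin \o (fun s => p.[eps s] * tilt (eps s))).
Proof.
have [C pC] := continuous_bounded_itv _ (Num.sqrt M.+1%:R) (continuous_poly_tilt p).
apply: (integrable_sphere lam ulam _ C).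
  apply: (measurableT_comp (continuous_measurable_fun (continuous_poly_tilt p))).
  exact: measurable_eps.
by move=> s Ss; apply: pC; exact: sphere_coord.
Qed.

Lemma tilt_intD p q : tilt_int (p + q) = tilt_int p + tilt_int q.
Proof.
rewrite /tilt_int -RintegralD//; do ?exact: integrable_poly_tilt.
by apply: eq_Rintegral => s _; rewrite hornerD mulrDl.
Qed.

Lemma tilt_intZ c p : tilt_int (c *: p) = c * tilt_int p.
Proof.
rewrite /tilt_int -RintegralZl//; do ?exact: integrable_poly_tilt.
by apply: eq_Rintegral => s _; rewrite hornerZ mulrA.
Qed.

Lemma tilt_intB p q : tilt_int (p - q) = tilt_int p - tilt_int q.
Proof. by rewrite tilt_intD -scaleN1r tilt_intZ mulN1r. Qed.

Lemma eq_tilt_int p q : (forall x, p.[x] = q.[x]) -> tilt_int p = tilt_int q.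
Proof. by move=> pq; apply: eq_Rintegral => s _; rewrite pq. Qed.

Lemma tilt_int_ge0 p : (forall x, x ^+ 2 <= M.+1%:R -> 0 <= p.[x]) -> 0 <= tilt_int p.
Proof.
move=> p0; rewrite /tilt_int -(Rintegral_sphere lam ulam); last exact: integrable_poly_tilt.
apply: Rintegral_ge0 => s Ss; rewrite mulr_ge0 ?expR_ge0// p0//.
exact: sphere_eps_le.
Qed.

Lemma tilt_int1_gt0 : 0 < tilt_int 1.
Proof.
have cE : continuous (fun x : R => x * a - 2^-1 * x ^+ 2 * b).
  move=> x; apply/differentiable_continuous/derivable1_diffP.
  exact: ex_derive.
have [C EC] := continuous_bounded_itv _ (Num.sqrt M.+1%:R) cE.
apply: (@lt_le_trans _ _ (expR (- C))); first exact: expR_gt0.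
have [lS _] := ulam; have mS : measurable (sphere M.+1 : set (M.+1.-tuple R)) := measurable_sphere.
have -> : expR (- C) = \int[lam]_(s in sphere M.+1) cst (expR (- C)) s.
  by rewrite Rintegral_cst//= lS mulr1.
have int1 := integrable_poly_tilt 1.
rewrite /tilt_int -(Rintegral_sphere lam ulam)//; apply: le_Rintegral => //.
- apply: (@integrableS _ _ _ _ setT) => //.
  by apply: (integrable_sphere lam ulam _ `|expR (- C)|).
- exact: (@integrableS _ _ _ _ setT).
- move=> s Ss; rewrite hornerC mul1r /= ler_expR.
  have := EC (eps s) (sphere_coord _ ord_max Ss).
  by rewrite ler_norml => /andP[].
Qed.

Lemma tilt_stein p : M%:R * tilt_int ('X * p) =
  tilt_int ((M.+1%:R - 'X^2) * (p^`() + (a%:P - b *: 'X) * p)).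
Proof.
have := @stein R M lam ulam (fun x : R => p.[x] * tilt x) _ (is_derive_poly_tilt p)
  (continuous_poly_tilt _).
rewrite /tilt_int => H; transitivity (M%:R * \int[lam]_s (eps s * (p.[eps s] * tilt (eps s)))).
  by congr (_ * _); apply: eq_Rintegral => s _; rewrite hornerM hornerX mulrA.
rewrite H; apply: eq_Rintegral => s _; rewrite mulrA; congr (_ * _).
by rewrite hornerM; congr (_ * _); rewrite hornerD hornerN hornerXn -polyC_natr hornerC.
Qed.

Lemma tilt_moment_system : moment_system b M a (fun k => tilt_int 'X^k / tilt_int 1).
Proof.
have m0 := tilt_int1_gt0.
have mN : tilt_int 1 != 0 by rewrite gt_eqF.
have nonneg p : (forall x, x ^+ 2 <= M.+1%:R -> 0 <= p.[x]) -> 0 <= tilt_int p / tilt_int 1.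
  by move=> p0; apply: divr_ge0; [exact: tilt_int_ge0|exact: ltW].
pose N : R := M.+1%:R.
(* Stated for variable polynomials: rewriting with the linearity equations
   under concrete monomials triggers very slow unifications. *)
have r2 (c d e f : R) (p1 p2 p3 p4 : {poly R}) :
    tilt_int (N *: (c *: p1 - d *: p2) - (e *: p3 - f *: p4)) / tilt_int 1 =
    N * (c * (tilt_int p1 / tilt_int 1) - d * (tilt_int p2 / tilt_int 1))
    - (e * (tilt_int p3 / tilt_int 1) - f * (tilt_int p4 / tilt_int 1)).
  by rewrite tilt_intB tilt_intZ !tilt_intB !tilt_intZ; ring.
have r3 (c1 c2 c3 d1 d2 d3 : R) (p1 p2 p3 q1 q2 q3 : {poly R}) :
    tilt_int (N *: (c1 *: p1 + c2 *: p2 - c3 *: p3) - (d1 *: q1 + d2 *: q2 - d3 *: q3))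
      / tilt_int 1 =
    N * (c1 * (tilt_int p1 / tilt_int 1) + c2 * (tilt_int p2 / tilt_int 1)
         - c3 * (tilt_int p3 / tilt_int 1))
    - (d1 * (tilt_int q1 / tilt_int 1) + d2 * (tilt_int q2 / tilt_int 1)
         - d3 * (tilt_int q3 / tilt_int 1)).
  by rewrite tilt_intB tilt_intZ !tilt_intB !tilt_intD !tilt_intZ; ring.
have even_ge0 (x : R) p : 0 <= x ^+ p.*2 by rewrite -mul2n exprM exprn_ge0// sqr_ge0.
split.
- by rewrite expr0 divff.
- have H : M%:R * tilt_int 'X^1 =
      tilt_int (N *: (a *: 'X^0 - b *: 'X^1) - (a *: 'X^2 - b *: 'X^3)).
    have := tilt_stein 1; rewrite mulr1 => ->; apply: eq_tilt_int => x.
    rewrite -polyC_natr derivC add0r mulr1.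
    rewrite !(hornerXn, hornerD, hornerN, hornerZ, hornerM, hornerC, hornerX) ?exprS ?expr0.
    by rewrite /N; ring.
  by rewrite mulrA H r2.
- move=> j; have H : M%:R * tilt_int 'X^(j.+2) =
      tilt_int (N *: ((j.+1%:R : R) *: 'X^j + a *: 'X^(j.+1) - b *: 'X^(j.+2))
     - ((j.+1%:R : R) *: 'X^(j.+2) + a *: 'X^(j.+3) - b *: 'X^(j.+4))).
    have := tilt_stein 'X^(j.+1); rewrite -exprS => ->; apply: eq_tilt_int => x.
    rewrite -polyC_natr derivXn/=.
    rewrite !(hornerXn, hornerMn, hornerD, hornerN, hornerZ, hornerM, hornerC, hornerX) ?exprS.
    by rewrite /N; move: (x ^+ j) => w; ring.
  by rewrite mulrA H r3.
- by move=> p; apply: nonneg => x _; rewrite hornerXn.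
- move=> p; have rE (p1 p2 : {poly R}) : N * (tilt_int p1 / tilt_int 1)
      - tilt_int p2 / tilt_int 1 = tilt_int (N *: p1 - p2) / tilt_int 1.
    by rewrite tilt_intB tilt_intZ; ring.
  rewrite -subr_ge0 rE; apply: nonneg => x xN.
  rewrite hornerD hornerN hornerZ !hornerXn !exprS.
  have w0 := even_ge0 x p; move: (x ^+ p.*2) w0 => w w0.
  rewrite (_ : _ - _ = (M.+1%:R - x ^+ 2) * w); last by ring.
  by rewrite mulr_ge0// subr_ge0.
- move=> p.
  have rE (p0 p1 p2 p3 p4 : {poly R}) : 2^-1 * (2^-1 * (N * (tilt_int p2 / tilt_int 1)
        - tilt_int p4 / tilt_int 1) + 2 * a ^+ 2 * (N * (tilt_int p0 / tilt_int 1)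
        - tilt_int p2 / tilt_int 1))
      - a * (N * (tilt_int p1 / tilt_int 1) - tilt_int p3 / tilt_int 1) =
      tilt_int (2^-1 *: (2^-1 *: (N *: p2 - p4) + (2 * a ^+ 2) *: (N *: p0 - p2))
        - a *: (N *: p1 - p3)) / tilt_int 1.
    rewrite tilt_intB 2!tilt_intZ tilt_intD !tilt_intZ !tilt_intB !tilt_intZ; ring.
  rewrite -subr_ge0 rE; apply: nonneg => x xN.
  rewrite !(hornerXn, hornerD, hornerN, hornerZ) ?exprS.
  have w0 := even_ge0 x p; move: (x ^+ p.*2) w0 => w w0.
  (* The coefficients of [ms_amgm] are those of this square: [1/4] for [x^2], [- a] for [x] and
     [a^2]. *)
  rewrite (_ : _ - _ = (M.+1%:R - x ^+ 2) * w * (2^-1 * x - a) ^+ 2); last by field.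
  by rewrite mulr_ge0 ?sqr_ge0// mulr_ge0// subr_ge0.
- move=> k; have r1 : tilt_int 1 / tilt_int 1 = 1 by rewrite divff.
  have powle (x : R) : `|x ^+ k| <= 1 + x ^+ k.*2.
    rewrite -addnn exprD ler_norml; move: (x ^+ k) => u.
    have := sqr_ge0 (u - 1); have := sqr_ge0 (u + 1); rewrite !expr2 => *.
    by apply/andP; split; nra.
  have rE (c : R) (p q : {poly R}) : 1 + tilt_int q / tilt_int 1 - c * (tilt_int p / tilt_int 1)
      = tilt_int (1 + q - c *: p) / tilt_int 1.
    by rewrite tilt_intB tilt_intZ tilt_intD mulrBl mulrDl r1; ring.
  have pos c : `|c| = 1 ->
      0 <= 1 + tilt_int 'X^(k.*2) / tilt_int 1 - c * (tilt_int 'X^k / tilt_int 1).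
    move=> c1; rewrite rE; apply: nonneg => x _.
    rewrite !(hornerXn, hornerD, hornerN, hornerZ) hornerC subr_ge0.
    by rewrite (le_trans (ler_norm _))// normrM c1 mul1r.
  have := pos 1 (normr1 _); have := pos (- 1) (normrN1 _).
  rewrite mul1r mulN1r opprK => ? ?; rewrite ler_norml; apply/andP; split; lra.
Qed.

End tilted_moments.

(** * Gaussian integrals and independence *)

(** The Radon-Nikodym derivative has the same integrals over measurable sets as the normal density,
    hence equals it almost everywhere. *)
Lemma ge0_integral_normal_prob (R : realType) (m s : R) (f : measurableTypeR R -> \bar R) :
  measurable_fun setT f -> (forall x, 0 <= f x)%E ->
  (\int[normal_prob m s]_x f x =
   \int[lebesgue_measure]_x (f x * (normal_pdf m s x)%:E))%E.
Proof.
move=> mf f0; have dom := @normal_prob_dominates R m s.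
rewrite -(Radon_Nikodym_SigmaFinite.change_of_variables dom)//.
have mp : measurable_fun setT (fun x : measurableTypeR R => (normal_pdf m s x)%:E).
  by apply/measurable_EFinP; exact: measurable_normal_pdf.
have intg := Radon_Nikodym_SigmaFinite.f_integrable dom.
have mg := measurable_int _ intg.
apply: ge0_ae_eq_integral => //.
- exact: emeasurable_funM.
- exact: emeasurable_funM.
- by move=> x _; rewrite mule_ge0// Radon_Nikodym_SigmaFinite.f_ge0.
- by move=> x _; rewrite mule_ge0// lee_fin normal_pdf_ge0.
have : ae_eq lebesgue_measure setT
    (Radon_Nikodym_SigmaFinite.f (normal_prob m s) lebesgue_measure)
    (fun x : measurableTypeR R => (normal_pdf m s x)%:E).
  apply: integral_ae_eq => // E _ mE.
  by rewrite -Radon_Nikodym_SigmaFinite.f_integral.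
by apply: filterS => x + _ => -> //.
Qed.

Lemma gaussian_mgf (R : realType) d (T : measurableType d) (P : probability T R)
    (X : T -> R) (v c : R) : centered_gaussian P X v ->
  (\int[P]_w (expR (c * X w))%:E = (expR (c ^+ 2 * v / 2))%:E)%E.
Proof.
move=> [mX XG].
have mE : measurable_fun setT (fun w => (expR (c * X w))%:E).
  apply/measurable_EFinP; apply: measurableT_comp => //.
  exact: measurable_funM.
case: XG => [[-> X0]|[v0 XN]].
  have mN : measurable [set w | X w = 0].
    by rewrite -[X in measurable X]setTI; exact: (mX measurableT [set 0]).
  rewrite mulr0 mul0r expR0 (@ge0_negligible_integral _ _ _ _ _ (~` [set w | X w = 0]))//.
  - rewrite setTD setCK (eq_integral (cst 1%E)); last first.
      by move=> w /set_mem /= ->; rewrite mulr0 expR0.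
    by rewrite integral_cst//= mul1e X0.
  - exact: measurableC.
  - by have := probability_setC P mN; rewrite X0 subee.
set s := Num.sqrt v; have s0 : s != 0 by rewrite gt_eqF// sqrtr_gt0.
have s2 : s ^+ 2 = v by rewrite sqr_sqrtr// ltW.
have mexp : measurable_fun setT (fun x : measurableTypeR R => (expR (c * x))%:E).
  by apply/measurable_EFinP; apply: measurableT_comp => //; exact: measurable_funM.
transitivity (\int[normal_prob 0 s]_x (expR (c * x))%:E)%E.
  have mX' : measurable_fun setT (X : T -> measurableTypeR R) by exact: mX.
  rewrite -[LHS](@ge0_integral_pushforward _ _ _ _ R _ mX' P setT (fun x => (expR (c * x))%:E))//.
  by apply: eq_measure_integral => // A mA _; exact: XN.
rewrite ge0_integral_normal_prob//.
(* Completing the square: tilting by [exp (c x)] shifts the mean of the density to [c v]. *)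
rewrite (eq_integral (fun x : measurableTypeR R =>
    (expR (c ^+ 2 * v / 2))%:E * (normal_pdf (c * v) s x)%:E)%E); last first.
  move=> x _; rewrite -!EFinM !normal_pdfE//; congr (_%:E).
  rewrite mulrCA [RHS]mulrCA /normal_fun -!expRD; congr (_ * expR _).
  by rewrite s2; field; rewrite gt_eqF.
rewrite ge0_integralZl//.
- by rewrite integral_normal_pdf mule1.
- by apply/measurable_EFinP; exact: measurable_normal_pdf.
- by move=> x _; rewrite lee_fin normal_pdf_ge0.
Qed.

Section independent_integral.
Local Open Scope ereal_scope.
Context {R : realType} {d d1 d2} {T : measurableType d} {T1 : measurableType d1}
  {T2 : measurableType d2} (P : probability T R) (X : T -> T1) (Y : T -> T2).
Hypothesis mX : measurable_fun setT X.
Hypothesis mY : measurable_fun setT Y.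
Hypothesis XY : forall A B, measurable A -> measurable B ->
  P (X @^-1` A `&` Y @^-1` B) = P (X @^-1` A) * P (Y @^-1` B).

(** Independence makes the joint law a product measure, and Tonelli factors the integral. *)
Lemma ge0_integral_indep (f : T1 -> \bar R) (g : T2 -> \bar R) :
  measurable_fun setT f -> measurable_fun setT g ->
  (forall x, 0 <= f x) -> (forall y, 0 <= g y) ->
  \int[P]_w (f (X w) * g (Y w)) = (\int[P]_w f (X w)) * (\int[P]_w g (Y w)).
Proof.
move=> mf mg f0 g0.
pose Xm : {mfun T >-> T1} := HB.pack X (isMeasurableFun.Build _ _ _ _ _ mX).
pose Ym : {mfun T >-> T2} := HB.pack Y (isMeasurableFun.Build _ _ _ _ _ mY).
have mXY : measurable_fun setT (fun w => (X w, Y w)).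
  exact: measurable_fun_pair.
pose XYm : {mfun T >-> (T1 * T2)%type} :=
  HB.pack (fun w => (X w, Y w)) (isMeasurableFun.Build _ _ _ _ _ mXY).
pose F (xy : T1 * T2) := f xy.1 * g xy.2.
have mF : measurable_fun setT F.
  by apply: emeasurable_funM; exact: measurableT_comp.
have F0 xy : 0 <= F xy by rewrite mule_ge0.
have XYE A : measurable A ->
    distribution P XYm A = (distribution P Xm \x distribution P Ym) A.
  by move=> mA; apply/esym/product_measure_unique.
transitivity (\int[distribution P XYm]_xy F xy).
  by rewrite ge0_integral_distribution.
transitivity (\int[distribution P Xm \x distribution P Ym]_xy F xy).
  by apply: eq_measure_integral => A mA _; exact: XYE.
rewrite fubini_tonelli1//.
have -> : \int[P]_w f (X w) = \int[distribution P Xm]_x f x.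
  by rewrite ge0_integral_distribution.
have -> : \int[P]_w g (Y w) = \int[distribution P Ym]_y g y.
  by rewrite ge0_integral_distribution.
have G0 : 0 <= \int[distribution P Ym]_y g y by exact: integral_ge0.
rewrite -ge0_integralZr//; apply: eq_integral => x _.
by rewrite /fubini_F /F/= ge0_integralZl.
Qed.

End independent_integral.

(** * The Gibbs average *)

(** The constant [c] is what makes the induction go through: it collects the factors of the replicas
    already fixed. *)
Lemma iter_int_prod {R : realType} d (T : measurableType d)
    (mu : {measure set T -> \bar R}) n (F : nat -> T -> R) (c : R) :
  (forall l, mu.-integrable setT (EFin \o F l)) ->
  iter_int mu n (fun s => c * \prod_(l < n) F l (nth point s l)) =
  c * \prod_(l < n) \int[mu]_x F l x.
Proof.
elim: n F c => [|n IH] F c intF /=; first by rewrite !big_ord0.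
transitivity (\int[mu]_x (c * (\prod_(l < n) \int[mu]_y F l.+1 y) * F 0%N x)).
  apply: eq_Rintegral => x _.
  transitivity (c * F 0%N x * \prod_(l < n) \int[mu]_y F l.+1 y); last by ring.
  rewrite -(IH (fun l => F l.+1)); last by move=> l; exact: intF.
  congr iter_int; apply/funext => s; rewrite big_ord_recl/= mulrA.
  by congr (_ * _); apply: eq_bigr.
by rewrite RintegralZl// big_ord_recl/=; ring.
Qed.

Section gibbs.
Context {R : realType} {M : nat}.
Variable lam : probability (M.+1.-tuple R) R.
Hypothesis ulam : uniform_on_sphere M.+1 lam.
Hypothesis M0 : (0 < M)%N.
Variable W : M.-tuple R -> R.
Hypothesis mW : measurable_fun setT W.
Hypothesis W_gt0 : forall x, 0 < W x.

(** Extended real valued, since it may be infinite for exceptional disorder. *)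
Definition hat_mass : \bar R := (\int[lam]_s (W (hat s))%:E)%E.

Let mWhat : measurable_fun setT (fun s : M.+1.-tuple R => W (hat s)).
Proof. by apply: (measurableT_comp mW); exact: measurable_hat. Qed.

Lemma hat_mass_gt0 : (0 < hat_mass)%E.
Proof.
rewrite lt_neqAle integral_ge0 ?andbT; last by move=> s _; rewrite lee_fin ltW.
apply/eqP => Z0.
have mEW : measurable_fun setT (fun s : M.+1.-tuple R => (W (hat s))%:E).
  exact/measurable_EFinP.
have /(ae_eq_integral_abs lam measurableT mEW) : (\int[lam]_s `|(W (hat s))%:E| = 0)%E.
  by rewrite Z0; apply: eq_integral => s _; rewrite gee0_abs// lee_fin ltW.
move=> [A [mA A0 sub]]; have : lam setT = 0%E.
  apply: subset_measure0 A0 => // s _; apply: sub => /= /(_ I) [W0].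
  by have := W_gt0 (hat s); rewrite W0 ltxx.
by rewrite probability_setT => /eqP; rewrite onee_eq0.
Qed.

Let ge0_hat_eps (g : R -> R) : measurable_fun setT g -> (forall x, 0 <= g x) ->
  (\int[lam]_s (W (hat s) * g (eps s))%:E = hat_mass * \int[lam]_s (g (eps s))%:E)%E.
Proof.
move=> mg g0; under eq_integral do rewrite EFinM.
apply: (ge0_integral_indep lam hat eps _ _ _ (EFin \o W) (EFin \o g)) => //.
- exact: measurable_hat.
- exact: measurable_eps.
- by move=> A B mA mB; exact: hat_eps_indep.
- exact/measurable_EFinP.
- exact/measurable_EFinP.
- by move=> x; rewrite lee_fin ltW.
Qed.

Let ge0_hat_eps_fin (g : R -> R) : (hat_mass < +oo)%E ->
  measurable_fun setT g -> (forall x, 0 <= g x) ->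
  lam.-integrable setT (EFin \o (fun s => g (eps s))) ->
  lam.-integrable setT (EFin \o (fun s => W (hat s) * g (eps s))) /\
  \int[lam]_s (W (hat s) * g (eps s)) = fine hat_mass * \int[lam]_s g (eps s).
Proof.
move=> Zoo mg g0 intg.
have Zfin : hat_mass \is a fin_num by rewrite ge0_fin_numE// ltW// hat_mass_gt0.
have gfin : (\int[lam]_s (g (eps s))%:E)%E \is a fin_num by exact: integrable_fin_num.
split; last by rewrite /Rintegral ge0_hat_eps// fineM.
have mge : measurable_fun setT (fun s : M.+1.-tuple R => g (eps s)).
  by apply: (measurableT_comp mg); exact: measurable_eps.
apply/integrableP; split; first by apply/measurable_EFinP; exact: measurable_funM.
under eq_integral do rewrite /= ger0_norm ?mulr_ge0 ?(ltW (W_gt0 _))//.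
by rewrite ge0_hat_eps// ltey_eq fin_numM.
Qed.

Lemma integral_hat_eps (g : R -> R) : (hat_mass < +oo)%E ->
  measurable_fun setT g ->
  lam.-integrable setT (EFin \o (fun s => g (eps s))) ->
  lam.-integrable setT (EFin \o (fun s => W (hat s) * g (eps s))) /\
  \int[lam]_s (W (hat s) * g (eps s)) = fine hat_mass * \int[lam]_s g (eps s).
Proof.
move=> Zoo mg intg.
(* [g] is the difference of two nonnegative functions, to which the product formula applies. *)
pose g1 x := `|g x| + g x; pose g2 x := `|g x|.
have mg2 : measurable_fun setT g2 by exact: measurableT_comp.
have mg1 : measurable_fun setT g1 by exact: measurable_funD.
have int2 : lam.-integrable setT (EFin \o (fun s => g2 (eps s))).
  exact: (integrable_norm intg).
have int1 : lam.-integrable setT (EFin \o (fun s => g1 (eps s))).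
  exact: (integrableD measurableT int2 intg).
have g20 x : 0 <= g2 x by exact: normr_ge0.
have g10 x : 0 <= g1 x by have := ler_norm (- g x); rewrite normrN /g1; lra.
have [i1 E1] := ge0_hat_eps_fin g1 Zoo mg1 g10 int1.
have [i2 E2] := ge0_hat_eps_fin g2 Zoo mg2 g20 int2.
have WE : (fun s => W (hat s) * g (eps s)) =
    (fun s => W (hat s) * g1 (eps s) - W (hat s) * g2 (eps s)).
  by apply/funext => s; rewrite /g1 /g2; ring.
rewrite WE; split; first exact: (integrableB measurableT i1 i2).
rewrite RintegralB// E1 E2 -mulrBr -RintegralB//; congr (_ * _).
by apply: eq_Rintegral => s _; rewrite /g1 /g2; ring.
Qed.

(** If the mass is finite, its [size k]-th power cancels. If it is infinite, [Rintegral] gives the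
    partition function the value 0, and dividing by its positive power gives 0. *)
Lemma gibbs_avgE (a b : R) (H0 : M.+1.-tuple R -> R) (k : seq nat) : k != [::] ->
  (forall s, expR (H0 s) = W (hat s) * tilt a b (eps s)) ->
  gibbs_avg lam H0 (size k)
    (fun s => \prod_(l < size k) eps (nth point s l) ^+ nth 0%N k l) =
  if (hat_mass < +oo)%E then
    \prod_(j <- k) (tilt_int lam a b 'X^j / tilt_int lam a b 1) else 0.
Proof.
move=> kn H0E; rewrite /gibbs_avg.
have mt (p : {poly R}) : measurable_fun setT (fun x : R => p.[x] * tilt a b x).
  exact: continuous_measurable_fun (continuous_poly_tilt a b p).
have Z0E : \int[lam]_s expR (H0 s) =
    \int[lam]_s (W (hat s) * ((1 : {poly R}).[eps s] * tilt a b (eps s))).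
  by apply: eq_Rintegral => s _; rewrite H0E hornerC mul1r.
rewrite Z0E; case: ifPn => [Zoo|]; last first.
  rewrite -leNgt leye_eq => /eqP Zoo.
  rewrite {1}/Rintegral (ge0_hat_eps (fun x => (1 : {poly R}).[x] * tilt a b x))//; last first.
    by move=> x; rewrite hornerC mul1r expR_ge0.
  rewrite Zoo.
  have int1 := integrable_poly_tilt lam ulam a b 1.
  have : (0 < \int[lam]_s ((1 : {poly R}).[eps s] * tilt a b (eps s))%:E)%E.
    rewrite -[X in (_ < X)%E]fineK ?lte_fin; last exact: integrable_fin_num.
    exact: tilt_int1_gt0.
  move=> t0; rewrite gt0_mulye// /= expr0n size_eq0 (negbTE kn) invr0 mulr0//.
have intp p := integral_hat_eps _ Zoo (mt p) (integrable_poly_tilt lam ulam a b p).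
rewrite (intp 1).2.
pose F l s := W (hat s) * ('X^(nth 0%N k l).[eps s] * tilt a b (eps s)).
rewrite (_ : (fun s => _ * expR _) =
    (fun s => 1 * \prod_(l < size k) F l (nth point s l))); last first.
  apply/funext => s; rewrite mul1r expR_sum -big_split/=; apply: eq_bigr => l _.
  by rewrite /F H0E hornerXn; ring.
rewrite (iter_int_prod _ _ lam (size k) F 1); last by move=> l; exact: (intp _).1.
have fZ : fine hat_mass != 0.
  by rewrite gt_eqF// fine_gt0// hat_mass_gt0.
rewrite mul1r (big_nth 0%N) big_mkord.
rewrite -[X in _ ^+ X]card_ord -prodr_const -prodf_div; apply: eq_bigr => l _.
rewrite /F (intp _).2 /tilt_int invfM mulrACA divff// mul1r//.
Qed.

End gibbs.

(** * Averaging over the disorder *)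

Lemma pow_1D_sqr_le_expR {R : realType} (a : R) s :
  (1 + a ^+ 2) ^+ s <= 4 ^+ s * (expR (s%:R * a) + expR (- (s%:R * a))).
Proof.
(* From [(1 + x/2)^2 <= exp x], whose left side times 4 is [4 + 4 x + x^2]. *)
have one (x : R) : 0 <= x -> 1 + x ^+ 2 <= 4 * expR x.
  move=> x0; have := expR_ge1Dx (x / 2).
  have -> : expR x = expR (x / 2) ^+ 2 by rewrite -expRM_natl; congr expR; field.
  move=> H; have x2 : 0 <= 1 + x / 2 by rewrite addr_ge0// divr_ge0.
  by have := ler_pM x2 x2 H H; rewrite -expr2; nra.
have -> : a ^+ 2 = `|a| ^+ 2 by rewrite real_normK// num_real.
apply: (@le_trans _ _ ((4 * expR `|a|) ^+ s)).
  apply: lerXn2r; last exact: one.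
    by rewrite nnegrE addr_ge0// sqr_ge0.
  by rewrite nnegrE mulr_ge0// expR_ge0.
rewrite exprMn ler_wpM2l ?exprn_ge0// -expRM_natl.
have [a0|a0] := leP 0 a.
  by rewrite ger0_norm// lerDl expR_ge0.
by rewrite ltr0_norm// mulrN lerDr expR_ge0.
Qed.

Section gaussian_field.
Context {R : realType} {d} {T : measurableType d} (P : probability T R).

(** The bound is explicit because the final constant must be fixed before [M] and the probability
    space. *)
Lemma std_gaussian_pow (z : T -> R) (c h : R) s : std_gaussian P z ->
  P.-integrable setT (EFin \o (fun w => (1 + (z w * c + h) ^+ 2) ^+ s)) /\
  \int[P]_w ((1 + (z w * c + h) ^+ 2) ^+ s) <=
    4 ^+ s * (expR (s%:R * h) + expR (- (s%:R * h))) * expR ((s%:R * c) ^+ 2 / 2).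
Proof.
move=> zG; have mz : measurable_fun setT z by case: zG.
pose f w := (1 + (z w * c + h) ^+ 2) ^+ s.
pose e1 := expR (s%:R * h); pose e2 := expR (- (s%:R * h)).
have f0 w : 0 <= f w by rewrite exprn_ge0// addr_ge0// sqr_ge0.
have mf : measurable_fun setT f.
  apply: measurable_funX; apply: measurable_funD => //; apply: measurable_funX.
  by apply: measurable_funD => //; exact: measurable_funM.
have mexp t : measurable_fun setT (fun w => expR (t * z w)).
  by apply: measurableT_comp => //; exact: measurable_funM.
have mEexp t : measurable_fun setT (fun w => (expR (t * z w))%:E).
  by apply/measurable_EFinP; exact: mexp.
have fle w : f w <= 4 ^+ s * (e1 * expR ((s%:R * c) * z w) + e2 * expR (- (s%:R * c) * z w)).
  apply: le_trans (pow_1D_sqr_le_expR _ _) _.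
  rewrite ler_wpM2l ?exprn_ge0// -!expRD lerD// ler_expR; lra.
have intf : (\int[P]_w (f w)%:E <=
    (4 ^+ s * (e1 + e2) * expR ((s%:R * c) ^+ 2 / 2))%:E)%E.
  apply: (@le_trans _ _ (\int[P]_w ((4 ^+ s * e1)%:E * (expR ((s%:R * c) * z w))%:E
      + (4 ^+ s * e2)%:E * (expR (- (s%:R * c) * z w))%:E))%E).
    apply: ge0_le_integral => //.
    - by move=> w _; rewrite lee_fin.
    - exact/measurable_EFinP.
    - by apply: emeasurable_funD; apply: emeasurable_funM => //; exact: mEexp.
    - by move=> w _; rewrite -!EFinM -EFinD lee_fin (le_trans (fle w))// mulrDr !mulrA.
  have pos t : 0 <= 4 ^+ s * expR t by rewrite mulr_ge0 ?exprn_ge0 ?expR_ge0.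
  rewrite ge0_integralD//; last 4 first.
  - by move=> w _; rewrite -EFinM lee_fin mulr_ge0 ?expR_ge0 ?pos.
  - by apply: emeasurable_funM => //; exact: mEexp.
  - by move=> w _; rewrite -EFinM lee_fin mulr_ge0 ?expR_ge0 ?pos.
  - by apply: emeasurable_funM => //; exact: mEexp.
  rewrite !ge0_integralZl//; try exact: mEexp; try by rewrite lee_fin pos.
  rewrite !(gaussian_mgf _ _ _ P z 1)// -!EFinM -EFinD lee_fin sqrrN !mulr1.
  by rewrite mulrDr mulrDl.
split.
  apply/integrableP; split; first exact/measurable_EFinP.
  rewrite (eq_integral (fun w => (f w)%:E)) ?(le_lt_trans intf) ?ltry// => w _.
  by rewrite /= ger0_norm// f0.
have If : (\int[P]_w (f w)%:E)%E \is a fin_num.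
  rewrite ge0_fin_numE ?(le_lt_trans intf) ?ltry//.
  by apply: integral_ge0 => w _; rewrite lee_fin.
by rewrite -lee_fin /Rintegral fineK.
Qed.

Lemma gaussian_process_pt m (xi : R -> R) (H : T -> m.-tuple R -> R) x : (0 < m)%N ->
  gaussian_process P m xi H -> sphere m x ->
  centered_gaussian P (H ^~ x) (m%:R * xi 1).
Proof.
move=> m0 [_ G] Sx; have := G 1%N (fun=> x) (fun=> 1) (fun=> Sx).
rewrite !big_ord1 !mul1r /overlap.
have -> : \sum_(i < m) tnth x i * tnth x i = m%:R by exact/sphereE.
rewrite mulVf ?pnatr_eq0 -?lt0n// (_ : (fun w => _) = H ^~ x)//.
by apply/funext => w; rewrite big_ord1 mul1r.
Qed.

End gaussian_field.

(** * Almost sure finiteness of the mass *)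

Section mass.
Context {R : realType} {M : nat} {d} {T : measurableType d} (P : probability T R).
Variable lam : probability (M.+1.-tuple R) R.
Hypothesis ulam : uniform_on_sphere M.+1 lam.
Hypothesis M0 : (0 < M)%N.
Variables (xi : R -> R) (Hp : T -> M.-tuple R -> R) (beta h : R).
Hypothesis GH : gaussian_process P M xi Hp.

Definition field_weight w (x : M.-tuple R) : R :=
  expR (beta * Hp w x + h * \sum_(i < M) tnth x i).

Lemma measurable_field_weight2 :
  measurable_fun setT (fun p : T * M.-tuple R => field_weight p.1 p.2).
Proof.
case: GH => mH _; apply: measurableT_comp => //; apply: measurable_funD.
  exact: measurable_funM.
apply: measurable_funM => //; apply: measurable_sum => i.
by apply: (measurableT_comp (measurable_tnth i)).
Qed.

Let mWh : measurable_fun setT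
  (fun p : T * M.+1.-tuple R => (field_weight p.1 (hat p.2))%:E).
Proof.
apply/measurable_EFinP; apply: (measurableT_comp measurable_field_weight2
  (g := fun p : T * M.+1.-tuple R => (p.1, hat p.2))).
apply: measurable_fun_pair => //.
by apply: (measurableT_comp measurable_hat).
Qed.

Lemma measurable_hat_mass : measurable_fun setT (fun w => hat_mass lam (field_weight w)).
Proof.
by apply: (measurable_fun_fubini_tonelli_F _ mWh) => p; rewrite lee_fin expR_ge0.
Qed.

Lemma field_weight_mean x : sphere M x ->
  (\int[P]_w (field_weight w x)%:E <=
   (expR (`|h| * (2 * M%:R)) * expR (beta ^+ 2 * (M%:R * xi 1) / 2))%:E)%E.
Proof.
move=> Sx; have Gx := gaussian_process_pt P M xi Hp x M0 GH Sx.
have mexp : measurable_fun setT (fun w => (expR (beta * Hp w x))%:E).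
  apply/measurable_EFinP; apply: measurableT_comp => //; apply: measurable_funM => //.
  by case: Gx.
have exp0 (t : R) : (0 <= (expR t)%:E)%E by rewrite lee_fin expR_ge0.
rewrite EFinM -(gaussian_mgf _ _ _ _ _ _ beta Gx) -ge0_integralZl//.
apply: ge0_le_integral => //.
- by move=> w _; exact: exp0.
- apply/measurable_EFinP; apply: (measurableT_comp measurable_field_weight2
    (g := fun w => (w, x))).
  exact: measurable_fun_pair.
- exact: emeasurable_funM.
- move=> w _; rewrite -EFinM -expRD lee_fin ler_expR addrC lerD2r.
  rewrite (le_trans (ler_norm _))// normrM ler_wpM2l//.
  rewrite (le_trans (ler_norm_sum _ _ _))//.
  (* On the sphere [|t| <= 1 + t^2] sums to [2 M], which bounds the external field. *)
  apply: (@le_trans _ _ (\sum_(i < M) (1 + tnth x i ^+ 2))).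
    apply: ler_sum => i _; rewrite -real_normK ?num_real//.
    by have := sqr_ge0 (`|tnth x i| - 1); rewrite !expr2; nra.
  rewrite big_split/= sumr_const card_ord; move: Sx; rewrite /sphere/= => ->.
  by rewrite mulr_natl mulr2n.
Qed.

Lemma measurable_hat_mass_fin :
  measurable [set w | (hat_mass lam (field_weight w) < +oo)%E].
Proof.
rewrite (_ : [set _ | _] = ~` ((fun w => hat_mass lam (field_weight w)) @^-1` [set +oo%E])).
  apply: measurableC; rewrite -[X in measurable X]setTI.
  by apply: measurable_hat_mass => //; exact: emeasurable_set1.
apply/seteqP; split => w /=; rewrite ltey; first by move/eqP.
by move=> H; apply/eqP.
Qed.

(** By Tonelli the mean of [hat_mass] is an average over the sphere of means bounded by
    [field_weight_mean], the same bound at every point. *)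
Lemma hat_mass_ae_fin :
  {ae P, forall w, (hat_mass lam (field_weight w) < +oo)%E}.
Proof.
have intZ : P.-integrable setT (fun w => hat_mass lam (field_weight w)).
  apply/integrableP; split; first exact: measurable_hat_mass.
  have Z0 w : (0 <= hat_mass lam (field_weight w))%E.
    by apply: integral_ge0 => s _; rewrite lee_fin expR_ge0.
  under eq_integral do rewrite gee0_abs//.
  rewrite /hat_mass (fubini_tonelli (fun p : T * M.+1.-tuple R =>
    (field_weight p.1 (hat p.2))%:E))//; last first.
    by move=> p; rewrite lee_fin expR_ge0.
  have F0 (p : T * M.+1.-tuple R) : (0 <= (field_weight p.1 (hat p.2))%:E)%E.
    by rewrite lee_fin expR_ge0.
  have mG := measurable_fun_fubini_tonelli_G (m1 := P) _ mWh F0.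
  have mS : measurable (@hat R M @^-1` sphere M).
    by rewrite -[X in measurable X]setTI; apply: measurable_hat => //; exact: measurable_sphere.
  rewrite (@ge0_negligible_integral _ _ _ _ _ (~` (@hat R M @^-1` sphere M)))//.
  - rewrite setTD setCK; set B := expR (`|h| * (2 * M%:R)) * expR (beta ^+ 2 * (M%:R * xi 1) / 2).
    apply: (@le_lt_trans _ _ (\int[lam]_(s in @hat R M @^-1` sphere M) B%:E)%E).
      apply: ge0_le_integral => //.
      + by move=> s _; apply: integral_ge0 => w _; rewrite lee_fin expR_ge0.
      + exact: measurable_funTS mG.
      + by move=> s Ss; have := field_weight_mean (hat s) Ss.
    by rewrite integral_cst//= hat_sphere_prob// mule1 ltry.
  - exact: measurableC.
  - by move=> s _; apply: integral_ge0 => w _; rewrite lee_fin expR_ge0.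
  - by have := probability_setC lam mS; rewrite hat_sphere_prob// subee.
have := integrable_ae measurableT intZ; apply: filterS => w /(_ I) fw.
by rewrite ltey_eq fw.
Qed.

End mass.

(** * Measurability in the disorder *)

Section tilt_measurability.
Context {R : realType} {M : nat} {d} {T : measurableType d}.
Variable lam : probability (M.+1.-tuple R) R.
Hypothesis ulam : uniform_on_sphere M.+1 lam.
Variables (a : T -> R) (b : R).
Hypothesis ma : measurable_fun setT a.

Lemma measurable_ge0_tilt_int (p : {poly R}) : (forall x, 0 <= p.[x]) ->
  measurable_fun setT (fun w => tilt_int lam (a w) b p).
Proof.
move=> p0.
pose f (ws : T * M.+1.-tuple R) : \bar R := (p.[eps ws.2] * tilt (a ws.1) b (eps ws.2))%:E.
have mep : measurable_fun setT (fun ws : T * M.+1.-tuple R => eps ws.2).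
  by apply: (measurableT_comp measurable_eps).
have mf : measurable_fun setT f.
  apply/measurable_EFinP; apply: measurable_funM.
    exact: (measurableT_comp (continuous_measurable_fun (@continuous_horner R p)) mep).
  apply: measurableT_comp => //; apply: measurable_funB.
    apply: measurable_funM => //; exact: measurableT_comp.
  by apply: measurable_funM => //; apply: measurable_funM => //; exact: measurable_funX.
have f0 ws : (0 <= f ws)%E by rewrite lee_fin mulr_ge0 ?expR_ge0.
have := measurable_fun_fubini_tonelli_F (m2 := lam) _ mf f0.
by move=> mF; apply: (measurableT_comp _ mF); exact: fine_measurable.
Qed.

Lemma measurable_tilt_moment k :
  measurable_fun setT (fun w => tilt_int lam (a w) b 'X^k / tilt_int lam (a w) b 1).
Proof.
(* Tonelli gives measurability for nonnegative integrands, and [X^k = p1 - p2] with both nonnegative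
   because [u^2 + u + 1 > 0]. The quotient is written as a power [- 1] to use measurability of
   [powR]. *)
pose p1 : {poly R} := 1 + 'X^(k.*2) + 'X^k; pose p2 : {poly R} := 1 + 'X^(k.*2).
have pow0 (x : R) : 0 <= x ^+ k.*2 by rewrite -mul2n exprM exprn_ge0// sqr_ge0.
have -> : (fun w => tilt_int lam (a w) b 'X^k / tilt_int lam (a w) b 1) =
    (fun w => (tilt_int lam (a w) b p1 - tilt_int lam (a w) b p2) *
              tilt_int lam (a w) b 1 `^ (- 1)).
  apply/funext => w; rewrite -tilt_intB// powR_inv1 ?ltW ?tilt_int1_gt0//.
  by congr (_ / _); apply: eq_tilt_int => x; rewrite /p1 addrAC subrr add0r.
apply: measurable_funM.
  apply: measurable_funB; apply: measurable_ge0_tilt_int => x.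
    rewrite /p1 !(hornerXn, hornerD) hornerC -addnn exprD.
    by move: (x ^+ k) => u; have := sqr_ge0 (u + 2^-1); rewrite expr2; nra.
  by rewrite /p2 !(hornerXn, hornerD) hornerC addr_ge0.
apply: (measurableT_comp (measurable_powR (- 1))).
by apply: measurable_ge0_tilt_int => x; rewrite hornerC.
Qed.

Lemma measurable_gamma_seq k : measurable_fun setT (fun w => gamma_seq (a w) b k).
Proof.
have ma1 : measurable_fun setT (fun w => a w / (b + 1)) by exact: measurable_funM.
suff : measurable_fun setT (fun w => gamma_seq (a w) b k) /\
  measurable_fun setT (fun w => gamma_seq (a w) b k.+1) by case.
elim: k => [|k [IH1 IH2]]; split => //.
by apply: measurable_funD; exact: measurable_funM.
Qed.

Lemma measurable_prod_seq (f : T -> nat -> R) (ks : seq nat) :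
  (forall k, measurable_fun setT (f ^~ k)) ->
  measurable_fun setT (fun w => \prod_(k <- ks) f w k).
Proof.
move=> mf; elim: ks => [|k ks IH].
  by rewrite (_ : (fun w => _) = cst 1)//; apply/funext => w; rewrite big_nil.
rewrite (_ : (fun w => _) = (fun w => f w k * \prod_(k <- ks) f w k)).
  exact: measurable_funM.
by apply/funext => w; rewrite big_cons.
Qed.

End tilt_measurability.

Theorem theorem4 (R : realType) (xi : R -> R) (h : R) :
  C3 xi -> h != 0 ->
  exists beta0 : R, 0 < beta0 /\
  forall beta q : R, 0 < beta -> beta < beta0 ->
    0 <= q -> q < 1 ->
    h ^+ 2 + beta ^+ 2 * derive1 xi q = q / (1 - q) ^+ 2 ->
    0 <= derive1 xi q ->
    (forall q' : R, 0 <= q' -> q' < 1 ->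
       h ^+ 2 + beta ^+ 2 * derive1 xi q' = q' / (1 - q') ^+ 2 ->
       0 <= derive1 xi q' -> q' = q) ->
    forall k : seq nat, k != [::] ->
    exists L : R, forall M : nat, (1 <= M)%N ->
      forall (d : measure_display) (T : measurableType d) (P : probability T R)
             (Hp : T -> M.-tuple R -> R) (z : T -> R)
             (lam : probability (M.+1.-tuple R) R),
      uniform_on_sphere M.+1 lam ->
      gaussian_process P M xi Hp ->
      std_gaussian P z ->
      indep_of_process P M z Hp ->
      let b := h ^+ 2 * (1 - q) + beta ^+ 2 * (1 - q) * derive1 xi q in
      let a := fun w => z w * beta * Num.sqrt (derive1 xi q) + h in
      let H0 := fun w (s : M.+1.-tuple R) =>
        beta * Hp w (hat s) + h * \sum_(i < M) tnth (hat s) i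
        + eps s * a w - 2^-1 * eps s ^+ 2 * b in
      let n := size k in
      `| Rintegral P setT (fun w =>
            gibbs_avg lam (H0 w) n
              (fun s => \prod_(l < n) eps (nth point s l) ^+ nth 0%N k l))
         - Rintegral P setT (fun w =>
            \prod_(l < n) gamma_seq (a w) b (nth 0%N k l)) |
      <= L / M.+1%:R.
Proof.
move=> _ _; exists 1; split => // beta q beta_gt0 _ q_ge0 q_lt1 _ dxi_ge0 _ k kn.
set b := h ^+ 2 * (1 - q) + beta ^+ 2 * (1 - q) * derive1 xi q.
have b_ge0 : 0 <= b.
  have q1 : 0 <= 1 - q by rewrite subr_ge0 ltW.
  by rewrite addr_ge0 ?(mulr_ge0 (mulr_ge0 (sqr_ge0 beta) q1) dxi_ge0)// mulr_ge0// sqr_ge0.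
pose c := beta * Num.sqrt (derive1 xi q).
pose K (s : nat) : R := 4 ^+ s * (expR (s%:R * h) + expR (- (s%:R * h)))
  * expR ((s%:R * c) ^+ 2 / 2).
have [C [s errC]] := product_error b b_ge0 k.
have [C' [s' gamC]] := poly_bounded_prod_gamma b k.
(* [K s] bounds the mean of [(1 + a^2)^s]; the factor 2 pays for passing from [1 / M] to
   [1 / (M + 1)]. *)
exists (2 * (`|C| * K s)) => M M_gt0 d T P Hp z lam ulam GH zG _.
pose a w : R := z w * beta * Num.sqrt (derive1 xi q) + h.
pose H0 w (s0 : M.+1.-tuple R) := beta * Hp w (hat s0)
  + h * \sum_(i < M) tnth (hat s0) i + eps s0 * a w - 2^-1 * eps s0 ^+ 2 * b.
pose f (s0 : seq (M.+1.-tuple R)) :=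
  \prod_(l < size k) eps (nth point s0 l) ^+ nth 0%N k l.
suff : `| \int[P]_w gibbs_avg lam (H0 w) (size k) f
    - \int[P]_w \prod_(l < size k) gamma_seq (a w) b (nth 0%N k l) |
    <= 2 * (`|C| * K s) / M.+1%:R by [].
have aE : a = fun w => z w * c + h.
  by apply/funext => w; rewrite /a /c mulrA.
have mz : measurable_fun setT z by case: zG.
have ma : measurable_fun setT a.
  by rewrite aE; apply: measurable_funD => //; exact: measurable_funM.
pose r w j := tilt_int lam (a w) b 'X^j / tilt_int lam (a w) b 1.
have ms w : moment_system b M (a w) (r w) by exact: tilt_moment_system.
pose Y w := \prod_(j <- k) r w j.
pose G w := \prod_(j <- k) gamma_seq (a w) b j.
have mY : measurable_fun setT Y.
  by apply: measurable_prod_seq => j; exact: measurable_tilt_moment.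
have mG : measurable_fun setT G.
  by apply: measurable_prod_seq => j; exact: measurable_gamma_seq.
have M0 : 0 < M%:R :> R by rewrite ltr0n.
pose A t w := (1 + a w ^+ 2) ^+ t.
have A_ge0 t w : 0 <= A t w by rewrite exprn_ge0// addr_ge0// sqr_ge0.
have AK t : P.-integrable setT (EFin \o A t) /\ \int[P]_w A t w <= K t.
  rewrite /A aE; exact: std_gaussian_pow.
have intA D t : P.-integrable setT (EFin \o (fun w => D * A t w)).
  exact: (integrableZl measurableT D (AK t).1).
have err w : `|Y w - G w| <= M%:R^-1 * `|C| * A s w.
  have := errC M (a w) (r w) M_gt0 (ms w).
  rewrite normrM (ger0_norm (ltW M0)) -ler_pdivlMl// => /le_trans; apply.
  rewrite -mulrA; apply: ler_wpM2l; first by rewrite invr_ge0 ltW.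
  by apply: ler_wpM2r; [exact: A_ge0|exact: ler_norm].
(* Integrability of [G] and of [Y - G] comes from powers of [1 + a^2]; that of [Y] follows by
   addition. *)
have intG : P.-integrable setT (EFin \o G).
  apply: (le_integrable measurableT _ _ (intA C' s')); first exact/measurable_EFinP.
  move=> w _; rewrite lee_fin (le_trans (gamC M (a w) (r w) M_gt0 (ms w)))//.
  exact: ler_norm.
have intYG : P.-integrable setT (EFin \o (fun w => Y w - G w)).
  apply: (le_integrable measurableT _ _ (intA (M%:R^-1 * `|C|) s)).
    by apply/measurable_EFinP; exact: measurable_funB.
  by move=> w _; rewrite lee_fin (le_trans (err w))// ler_norm.
have intY : P.-integrable setT (EFin \o Y).
  rewrite (_ : Y = fun w => (Y w - G w) + G w); last by apply/funext => w; rewrite subrK.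
  exact: (integrableD measurableT intYG intG).
have gibbsE w : gibbs_avg lam (H0 w) (size k) f =
    if (hat_mass lam (field_weight Hp beta h w) < +oo)%E then Y w else 0.
  apply: gibbs_avgE => //.
  - have := measurable_field_weight2 P xi Hp beta h GH.
    move=> m2; apply: (measurableT_comp m2 (g := fun x => (w, x))).
    exact: measurable_fun_pair.
  - by move=> x; exact: expR_gt0.
  - by move=> x; rewrite /field_weight /tilt -expRD addrA.
(* The two integrands differ only where the mass is infinite, a null event. The indicator of finite
   mass makes the Gibbs average measurable. *)
have -> : \int[P]_w gibbs_avg lam (H0 w) (size k) f = \int[P]_w Y w.
  rewrite /Rintegral; congr fine; apply: ae_eq_integral => //.
  - apply/measurable_EFinP; rewrite (_ : (fun w => _) = fun w =>
        \1_[set w | (hat_mass lam (field_weight Hp beta h w) < +oo)%E] w * Y w).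
      apply: measurable_funM => //; apply: measurable_indic.
      exact: (measurable_hat_mass_fin P lam xi Hp beta h GH).
    apply/funext => w; rewrite gibbsE indicE; case: ifPn => H.
      by rewrite mem_set// mul1r.
    by rewrite memNset ?mul0r//; exact/negP.
  - exact/measurable_EFinP.
  - have := hat_mass_ae_fin P lam ulam M_gt0 xi Hp beta h GH.
    by apply: filterS => w Zoo _; rewrite gibbsE Zoo.
have -> : \int[P]_w \prod_(l < size k) gamma_seq (a w) b (nth 0%N k l) = \int[P]_w G w.
  by apply: eq_Rintegral => w _; rewrite /G (big_nth 0%N) big_mkord.
rewrite -RintegralB//.
apply: (le_trans (le_normr_Rintegral measurableT intYG)).
apply: (@le_trans _ _ (\int[P]_w (M%:R^-1 * `|C| * A s w))).
  apply: le_Rintegral => //; exact: (integrable_norm intYG).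
rewrite RintegralZl//; last exact: (AK s).1.
apply: (@le_trans _ _ (M%:R^-1 * (`|C| * K s))).
  rewrite mulrA; apply: ler_wpM2l; last exact: (AK s).2.
  by rewrite mulr_ge0// invr_ge0 ltW.
have CK : 0 <= `|C| * K s.
  by rewrite mulr_ge0// !mulr_ge0 ?addr_ge0 ?exprn_ge0 ?expR_ge0.
rewrite [leRHS]mulrAC; apply: ler_wpM2r => //.
(* What remains is [M + 1 <= 2 M]. *)
rewrite ler_pdivlMr// mulrC ler_pdivrMr// -natrM ler_nat.
by rewrite mul2n -addnn -addn1 leq_add2l.
Qed.
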